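(* Let $X$ be a graph, $q\in\mathbb{R}$, $M=M_q(X)$, and let $T=T(\omega,\eta)$ be a twin set in $X$. Let $\theta=q\deg(w)+\omega-\eta$ for $w\in T$ (this is an eigenvalue of $M$ with eigenvector $\mathbf{e}_u-\mathbf{e}_v$ for any $u,v\in T$). Then each vertex in $T$ is sedentary with respect to $M$ if and only if one of the following holds. (1) Either (i) $|T|\ge 3$, or (ii) $T=\{u,v\}$ and there is an eigenvector $\mathbf{w}\notin\operatorname{span}\{\mathbf{e}_u-\mathbf{e}_v\}$ of $M$ associated with $\theta$ such that $\mathbf{w}^T\mathbf{e}_u\neq 0$ or $\mathbf{w}^T\mathbf{e}_v\neq 0$. In this case, no vertex in $T$ is strongly cospectral with another vertex. (2) $\theta$ is a simple eigenvalue of $M$ (so that $T=\{u,v\}$ and $u$ and $v$ are strongly cospectral), and there are integers $m_j$ such that $$\sum_{\lambda_j\in\sigma^+_{uv}(M)}m_j(\lambda_j-\theta)=0\quad\text{and}\quad \sum_{\lambda_j\in\sigma^+_{uv}(M)}m_j\ \text{is odd}.$$ If in addition $\phi(M,t)\in\mathbb{Z}[t]$ and $u$ is periodic, then the latter condition is equivalent to: each eigenvalue $\lambda_j\in\sigma^+_{uv}(M)$ is of the form $\lambda_j=\theta+b_j\sqrt{\Delta}$, where $b_j$ is an integer and either $\Delta=1$ or $\Delta>1$ is a square-free integer, and the $\nu_2(b_j)$'s are not all equal; in this case $u$ is tightly sedentary.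
   Context: Graphs are undirected, with positive edge weights, possibly with loops, no multiple edges. $A(X)$ weighted adjacency matrix, $\deg(u)=2\omega_{u,u}+\sum_{j\ne u}\omega_{u,j}$, $D(X)$ diagonal degree matrix, $M_q(X)=qD(X)+A(X)$; $\phi(M,t)$ is the characteristic polynomial; $U_M(t)=e^{itM}$. Spectral decomposition $M=\sum_j\lambda_jE_j$ ($E_j$ orthogonal projections onto eigenspaces of the distinct eigenvalues $\lambda_j$). $u,v$ strongly cospectral: $E_j\mathbf{e}_u=\pm E_j\mathbf{e}_v$ for all $j$; for such $u,v$, $\sigma^+_{uv}(M)=\{\lambda_j: E_j\mathbf{e}_u=E_j\mathbf{e}_v\neq 0\}$. $u$ is periodic if $|U_M(\tau)_{u,u}|=1$ for some $\tau>0$. $u$ is sedentary if $\inf_{t>0}|U_M(t)_{u,u}|\ge C$ for some $C>0$; tightly sedentary if moreover this infimum is positive and attained at some $t_0>0$. $\nu_2(a)$ denotes the exponent of the largest power of $2$ dividing the integer $a$. Twins: $N(u)\setminus\{u,v\}=N(v)\setminus\{u,v\}$, equal weights of $(u,w),(v,w)$ for common neighbours $w$, equal loop weights (zero if absent). A twin set $T=T(\omega,\eta)$ is a maximal set of $\ge 2$ pairwise twins, each with a loop of weight $\omega$, each pair joined by an edge of weight $\eta$ (weight $0$ meaning absent).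
   Formalization: In (1)(ii) w is taken orthogonal to e_u−e_v; in (2) ''θ simple'' is replaced by its consequence T={u,v} strongly cospectral; that the odd relation implies the form θ+b_j√Δ is proved only if the product of t−λ over the eigenvalue support of u lies in Z[t]. As printed these claims fail. *)

(* Defs.v *)
From HB Require Import structures.
From mathcomp Require Import all_boot all_order all_algebra.
From mathcomp Require Import all_classical all_reals all_analysis.
From mathcomp Require Import complex polyrcf.

Set Implicit Arguments.
Unset Strict Implicit.
Unset Printing Implicit Defensive.

Import Order.TTheory GRing.Theory Num.Theory.
Import numFieldNormedType.Exports.

Local Open Scope ring_scope.
Local Open Scope complex_scope.

(** * Weighted graphs *)

(* An undirected weighted graph on the vertices ['I_n].  Weight 0 encodes an
   absent edge (or, on the diagonal, an absent loop), so that the edges are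
   exactly the pairs of positive weight. *)
Record wgraph (R : realType) (n : nat) := WGraph {
  weight : 'I_n -> 'I_n -> R;
  weight_sym : forall u v, weight u v = weight v u;
  weight_ge0 : forall u v, 0 <= weight u v }.

Section Graph.
Variables (R : realType) (n : nat).
Implicit Types (X : wgraph R n) (u v w : 'I_n) (T : {set 'I_n}).

(* [u] belongs to its own neighbourhood when it carries a loop. *)
Definition nbhd X u : {set 'I_n} := [set w | 0 < weight X u w]%SET.

Definition deg X u : R := 2 * weight X u u + \sum_(j | j != u) weight X u j.

(* A loop counts once in [adjmx] but twice in [deg]. *)
Definition adjmx X : 'M[R]_n := \matrix_(u, v) weight X u v.
Definition degmx X : 'M[R]_n := diag_mx (\row_u deg X u).
Definition genadjmx (q : R) X : 'M[R]_n := q *: degmx X + adjmx X.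

Definition twins X u v : bool :=
  [&& u != v,
      nbhd X u :\: [set u; v]%SET == nbhd X v :\: [set u; v]%SET,
      [forall w in nbhd X u :\: [set u; v]%SET, weight X u w == weight X v w]
    & weight X u u == weight X v v].

Definition pairwise_twins X (om eta : R) T : bool :=
  [&& (2 <= #|T|)%N,
      [forall u in T, weight X u u == om]
    & [forall u in T, forall v in T,
         (u != v) ==> twins X u v && (weight X u v == eta)]].

Definition twin_set X (om eta : R) T : bool :=
  maxset (pairwise_twins X om eta) T.

End Graph.

(** * Spectral decomposition *)

Section Spectral.
Variables (R : realType) (n : nat).
Implicit Types (M : 'M[R]_n) (u v : 'I_n) (a : R).

(* Vectors are row vectors and matrices act on the right, as in [eigenspace];
   for the symmetric matrices considered here this is only a transposition. *)
Definition evec u : 'rV[R]_n := delta_mx 0 u.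

(* [rootsR p] lists the distinct real roots of [p <> 0]. *)
Definition spectrum M : seq R := rootsR (char_poly M).

(* Orthogonal projection onto the eigenspace of [a]: the row space of
   [kermx V^T] is the orthogonal complement of the row space of [V]. *)
Definition eigproj M a : 'M[R]_n :=
  proj_mx (eigenspace M a) (kermx (eigenspace M a)^T).

Definition strongly_cospectral M u v : Prop :=
  forall a, a \in spectrum M ->
    evec u *m eigproj M a = evec v *m eigproj M a \/
    evec u *m eigproj M a = - (evec v *m eigproj M a).

Definition sigma_plus M u v : seq R :=
  [seq a <- spectrum M |
    (evec u *m eigproj M a == evec v *m eigproj M a) &&
    (evec u *m eigproj M a != 0)].

Definition eigen_support M u : seq R :=
  [seq a <- spectrum M | evec u *m eigproj M a != 0].

Definition simple_eigenvalue M a : Prop := mup a (char_poly M) = 1%N.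

End Spectral.

(** * Continuous quantum walks *)

Definition expmx (K : numFieldType) (n : nat) (A : 'M[K]_n) : 'M[K]_n :=
  limn (series (fun k : nat => (k`!%:R)^-1 *: A ^+ k)).

Section Walk.
Variables (R : realType) (n : nat).
Implicit Types (M : 'M[R]_n) (u v : 'I_n).

Definition transition M (t : R) : 'M[R[i]]_n :=
  @expmx (R[i] : numFieldType) n ((t *i) *: map_mx (real_complex R) M).

Definition return_modulus M u (t : R) : R :=
  ComplexField.Normc.normc (transition M t u u).

Definition walk_periodic M u : Prop := exists2 t, 0 < t & return_modulus M u t = 1.

Definition inf_return M u : R :=
  inf [set return_modulus M u t | t in [set t : R | 0 < t]]%classic.

Definition sedentary M u : Prop := exists2 C, 0 < C & C <= inf_return M u.

Definition tightly_sedentary M u : Prop :=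
  [/\ sedentary M u, 0 < inf_return M u &
      exists2 t, 0 < t & return_modulus M u t = inf_return M u].

End Walk.

(** * The conditions of the characterization *)

Section Conditions.
Variables (R : realType) (n : nat).
Implicit Types (M : 'M[R]_n) (T : {set 'I_n}) (u v : 'I_n) (theta : R).

(* The eigenvector [z] is taken orthogonal to [e_u - e_v], i.e. from an
   orthogonal eigenbasis of the [theta]-eigenspace extending [e_u - e_v].
   Without orthogonality, [e_u - e_v + y] would be a witness for every
   [theta]-eigenvector [y] vanishing at both [u] and [v]; the 4-cycle (for its
   adjacency matrix) then satisfies the condition with no sedentary vertex. *)
Definition extra_eigenvector M theta u v : Prop :=
  exists z : 'rV[R]_n,
    [/\ z *m M = theta *: z,
        ~~ (z <= evec R u - evec R v)%MS,
        z *m (evec R u - evec R v)^T = 0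
      & z 0 u != 0 \/ z 0 v != 0].

Definition large_multiplicity M theta T : Prop :=
  (3 <= #|T|)%N \/
  exists u v, [/\ T = [set u; v]%SET, u != v & extra_eigenvector M theta u v].

Definition odd_relation M theta u v : Prop :=
  exists m : R -> int,
    \sum_(a <- sigma_plus M u v) (m a)%:~R * (a - theta) = 0 /\
    odd `|(\sum_(a <- sigma_plus M u v) m a)%R|%N.

Definition squarefree (d : nat) : Prop := forall k, (k ^ 2 %| d)%N -> k = 1%N.

(* [logn 2 `|b|] is the 2-adic valuation of [b <> 0]; here [b a <> 0] because
   [theta] does not belong to [sigma_plus M u v]. *)
Definition quadratic_form M theta u v : Prop :=
  exists (b : R -> int) (D : nat),
    [/\ D = 1%N \/ (1 < D)%N /\ squarefree D,
        forall a, a \in sigma_plus M u v ->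
          a = theta + (b a)%:~R * Num.sqrt D%:R
      & exists a c, [/\ a \in sigma_plus M u v, c \in sigma_plus M u v
          & logn 2 `|b a|%N != logn 2 `|b c|%N]].

(* For [char_poly M] in Z[t] this says that the eigenvalue support of [u] is
   closed under algebraic conjugation, which holds whenever [M] has rational
   entries: the product below is then the minimal polynomial of [M] relative
   to [e_u], a monic rational divisor of [char_poly M]. *)
Definition integral_support M u : Prop :=
  \prod_(a <- eigen_support M u) ('X - a%:P) \is a polyOver Num.int.

End Conditions.

(* Main.v *)
(* The vector [e_u - e_v] of a pair of twins is a [theta]-eigenvector, so every other eigenvector
   takes the same value at [u] and [v].  Hence the weight [(E_theta)_(u,u)] is [1/2 + |z|^2],
   where [z] is the part of [E_theta e_u] orthogonal to [e_u - e_v].  If [z != 0] the weight exceeds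
   [1/2] and the remaining terms of [U(t)_(u,u)] cannot cancel it.  If [z = 0] then [u] and [v] are
   strongly cospectral and, up to a phase, [U(t)_(u,u)] is
   [1/2 + \sum_(a in sigma^+) w_a e^(i t (a - theta))] with positive weights of sum [1/2].
   This comes arbitrarily close to [0] iff all the angles [t (a - theta)] can be brought
   arbitrarily close to [pi] modulo [2 pi]; by Kronecker's theorem this happens iff every integer
   relation between the numbers [a - theta] has an even coefficient sum.

   When [u] is periodic the numbers [a - theta] are integer multiples [k_a dl] of one real [dl].
   If the eigenvalue support is moreover the root set of a polynomial over [Z], its first two power
   sums show that [dl^2] is rational; so each [(a - theta)^2] is a rational algebraic integer, hence
   an integer, and [a - theta = b_a \sqrt D].  The relations are then those between the integers
   [b_a], and one with odd coefficient sum exists iff their 2-adic valuations are not all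
   equal. *)
Require Import Defs.
From mathcomp Require Import all_boot all_order all_algebra.
From mathcomp Require Import all_classical all_reals all_analysis.
From mathcomp Require Import complex polyrcf.
From mathcomp Require Import ring lra zify.

Set Implicit Arguments.
Unset Strict Implicit.
Unset Printing Implicit Defensive.

Import Order.TTheory GRing.Theory Num.Theory.
Import numFieldNormedType.Exports.

Local Open Scope ring_scope.

(** * Spectral decomposition of real symmetric matrices *)

Section RealSymmetric.
Variables (R : realType) (n : nat).
Implicit Types (M : 'M[R]_n) (x y : 'rV[R]_n) (a b : R).

Definition dot x y : R := (x *m y^T) 0 0.

Lemma dotE x y : dot x y = \sum_j x 0 j * y 0 j.
Proof. by rewrite /dot mxE; apply: eq_bigr => j _; rewrite mxE. Qed.

Lemma dotC x y : dot x y = dot y x.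
Proof. by rewrite !dotE; apply: eq_bigr => j _; rewrite mulrC. Qed.

Lemma dotDl x y z : dot (x + y) z = dot x z + dot y z.
Proof. by rewrite /dot mulmxDl mxE. Qed.

Lemma dotBl x y z : dot (x - y) z = dot x z - dot y z.
Proof. by rewrite /dot mulmxBl !mxE. Qed.

Lemma dotZl a x y : dot (a *: x) y = a * dot x y.
Proof. by rewrite /dot -scalemxAl mxE. Qed.

Lemma dotNl x y : dot (- x) y = - dot x y.
Proof. by rewrite /dot mulNmx mxE. Qed.

Lemma dot0l y : dot 0 y = 0.
Proof. by rewrite /dot mul0mx mxE. Qed.

Lemma dot_suml (I : Type) (r : seq I) (F : I -> 'rV[R]_n) y :
  dot (\sum_(i <- r) F i) y = \sum_(i <- r) dot (F i) y.
Proof. by rewrite /dot mulmx_suml summxE. Qed.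

Lemma dot_ge0 x : 0 <= dot x x.
Proof. by rewrite dotE sumr_ge0 // => j _; rewrite -expr2 sqr_ge0. Qed.

Lemma dot_eq0 x : (dot x x == 0) = (x == 0).
Proof.
apply/idP/eqP => [|->]; last by rewrite dot0l.
rewrite dotE psumr_eq0 => [/allP h|j _]; last by rewrite -expr2 sqr_ge0.
apply/rowP => j; rewrite mxE.
by have := h j; rewrite mem_index_enum => /(_ isT); rewrite /= -expr2 sqrf_eq0 => /eqP.
Qed.

Lemma dot_evec x u : dot x (evec R u) = x 0 u.
Proof.
rewrite dotE (bigD1 u) //= big1 => [|j ju]; rewrite !mxE ?eqxx ?mulr1 ?addr0 //.
by rewrite (negPf ju) mulr0.
Qed.

Lemma mem_spectrum M a : (a \in spectrum M) = eigenvalue M a.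
Proof.
have nz : char_poly M != 0 by exact/monic_neq0/char_poly_monic.
by rewrite eigenvalue_root_char -(roots_on_rootsR nz a) in_itv.
Qed.

Lemma spectrum_uniq M : uniq (spectrum M). Proof. exact: uniq_roots. Qed.

Section Symmetric.
Variables (M : 'M[R]_n) (symM : M^T = M).

Lemma eigenvector_spectrum x a : x *m M = a *: x -> x != 0 -> a \in spectrum M.
Proof. by move=> xM x0; rewrite mem_spectrum; apply/eigenvalueP; exists x. Qed.

Lemma eigenvectors_orth x y a b :
  x *m M = a *: x -> y *m M = b *: y -> a != b -> dot x y = 0.
Proof.
move=> xM yM ab; apply/eqP.
have : a * dot x y = b * dot x y.
  rewrite -dotZl -xM /dot -mulmxA -{1}symM -trmx_mul yM.
  by rewrite linearZ /= -scalemxAr mxE.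
by move/eqP; rewrite -subr_eq0 -mulrBl mulf_eq0 subr_eq0 (negPf ab).
Qed.

Lemma cap_eigenspace_compl a :
  (eigenspace M a :&: kermx (eigenspace M a)^T)%MS = 0.
Proof.
apply/eqP; rewrite -submx0; apply/rV_subP => x; rewrite sub_capmx submx0.
case/andP => /submxP[c ->]; rewrite sub_kermx => /eqP h.
by rewrite -dot_eq0 /dot trmx_mul mulmxA h mul0mx mxE.
Qed.

Lemma eigproj_id x a : x *m M = a *: x -> x *m eigproj M a = x.
Proof.
by move=> xM; rewrite proj_mx_id ?cap_eigenspace_compl //; apply/eigenspaceP.
Qed.

Lemma eigproj_eigenvector x a : x *m eigproj M a *m M = a *: (x *m eigproj M a).
Proof. by apply/eigenspaceP; rewrite proj_mx_sub. Qed.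

Lemma eigproj_0 y a b : y *m M = b *: y -> b != a -> y *m eigproj M a = 0.
Proof.
move=> yM ba; rewrite proj_mx_0 ?cap_eigenspace_compl // sub_kermx.
apply/eqP/rowP => j; rewrite mxE [RHS]mxE.
rewrite (eq_bigr (fun k => y 0 k * row j (eigenspace M a) 0 k)) => [|k _].
  rewrite -dotE (@eigenvectors_orth _ _ b a) //.
  exact/eigenspaceP/row_sub.
by rewrite !mxE.
Qed.

Lemma sum_eigproj_id y b :
  y *m M = b *: y -> y *m \sum_(a <- spectrum M) eigproj M a = y.
Proof.
move=> yM; have [->|y0] := eqVneq y 0; first by rewrite mul0mx.
have bs := eigenvector_spectrum yM y0.
rewrite mulmx_sumr (bigD1_seq b) ?spectrum_uniq //= eigproj_id // big1 ?addr0 //.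
by move=> a ab; rewrite (eigproj_0 yM) // eq_sym.
Qed.

Local Notation toC := (map_mx (real_complex R)).
Local Notation reC := (map_mx (@complex.Re R)).

Lemma ReZ (k : R) (z : R[i]%C) : complex.Re (k%:C%C * z) = k * complex.Re z.
Proof. by case: z => r s /=; rewrite mul0r subr0. Qed.

Lemma ImZ (k : R) (z : R[i]%C) : complex.Im (k%:C%C * z) = k * complex.Im z.
Proof. by case: z => r s /=; rewrite mul0r addr0. Qed.

Lemma Re_sum (I : Type) (r : seq I) (F : I -> R[i]%C) :
  complex.Re (\sum_(i <- r) F i) = \sum_(i <- r) complex.Re (F i).
Proof. by apply: (big_morph (@complex.Re R)) => // -[? ?] [? ?]. Qed.

Lemma Im_sum (I : Type) (r : seq I) (F : I -> R[i]%C) :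
  complex.Im (\sum_(i <- r) F i) = \sum_(i <- r) complex.Im (F i).
Proof. by apply: (big_morph (@complex.Im R)) => // -[? ?] [? ?]. Qed.

(** The complexification of [M] is Hermitian, so the spectral theorem diagonalizes it with real
    eigenvalues, although the rows of [P] may be complex. *)
Lemma real_eigenbasis : exists (P : 'M[R[i]%C]_n) (s : 'I_n -> R),
  P \in unitmx /\ forall i, row i P *m toC M = (s i)%:C%C *: row i P.
Proof.
pose A : 'M[R[i]%C]_n := toC M.
have Ah : A \is hermsymmx.
  apply: realsym_hermsym.
    apply/is_hermitianmxP; rewrite expr0 scale1r map_mx_id // /A.
    by rewrite map_trmx symM.
  by apply/mxOverP => i j; rewrite mxE; apply/complex_realP; exists (M i j).
have /orthomx_spectralP Ae := hermitian_normalmx Ah.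
have spR := hermitian_spectral_diag_real Ah.
have := spectral_unit A.
set P := spectralmx A in Ae *; set sp := spectral_diag A in Ae spR * => Pu.
exists P, (fun i => complex.Re (sp 0 i)); split=> // i.
have /complex_realP[r rE] : sp 0 i \is Num.real by exact: (mxOverP spR).
rewrite rE -row_mul -/A [in LHS]Ae -mulmxA mulKVmx //.
by rewrite mul_diag_mx; apply/rowP => j; rewrite !mxE rE.
Qed.

(* The real parts of the complex multiples of an eigenvector with real eigenvalue are real
   eigenvectors, and they span. *)
Lemma sum_eigproj : \sum_(a <- spectrum M) eigproj M a = 1%:M.
Proof.
have [P [s [Pu rowPA]]] := real_eigenbasis.
have reM (z : 'rV[R[i]%C]_n) : reC z *m M = reC (z *m toC M).
  apply/rowP => j; rewrite !mxE Re_sum; apply: eq_bigr => k _.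
  by rewrite !mxE [in RHS]mulrC ReZ mulrC.
apply/row_matrixP => i; rewrite rowE [RHS]rowE mulmx1.
set x : 'rV[R]_n := delta_mx 0 i.
pose c := toC x *m invmx P.
have -> : x = \sum_k reC (c 0 k *: row k P).
  have : toC x = \sum_k c 0 k *: row k P.
    by rewrite -mulmx_sum_row mulmxKV.
  move/(congr1 reC); rewrite -map_mx_comp map_mx_id // => ->.
  apply/rowP => j; rewrite mxE !summxE Re_sum; apply: eq_bigr => k _.
  by rewrite [RHS]mxE.
rewrite mulmx_suml; apply: eq_bigr => k _.
apply: (@sum_eigproj_id _ (s k)); rewrite reM -scalemxAl rowPA scalerA mulrC -scalerA.
by apply/rowP => j; rewrite 2!mxE ReZ [RHS]mxE [in RHS]mxE.
Qed.

(** [P] conjugates the complexified [M] to a diagonal matrix. Cancelling the nonzero [\det P]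
    equates the characteristic polynomials, and injectivity of the embedding brings the identity
    back to [R]. *)
Lemma char_poly_eigenbasis (P : 'M[R[i]%C]_n) (s : 'I_n -> R) : P \in unitmx ->
    (forall i, row i P *m toC M = (s i)%:C%C *: row i P) ->
  char_poly M = \prod_i ('X - (s i)%:P).
Proof.
move=> Pu rowPA; apply: (map_poly_inj (real_complex R)).
rewrite map_char_poly rmorph_prod /=.
under eq_bigr do rewrite rmorphB /= map_polyX map_polyC /=.
pose D := diag_mx (\row_i (s i)%:C%C).
have PA : P *m toC M = D *m P.
  by apply/row_matrixP => i; rewrite row_mul rowPA mul_diag_mx; apply/rowP => j; rewrite !mxE.
have -> : char_poly (toC M) = char_poly D.
  have dP : \det (map_mx polyC P) != 0.
    by rewrite det_map_mx polyC_eq0 -unitfE -unitmxE.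
  apply: (mulfI dP); rewrite [in RHS]mulrC /char_poly -!det_mulmx /char_poly_mx.
  by rewrite mulmxBr mulmxBl -!map_mxM PA scalar_mxC.
rewrite char_poly_trig ?diag_mx_is_trig //; apply: eq_bigr => i _.
by rewrite !mxE eqxx.
Qed.

(** Over the complex numbers the eigenspace is the line through one row of [P]; hence for [x != 0]
    the vector [y] is a multiple of [x], and orthogonality makes the multiple zero. *)
Lemma simple_eigenvectors x y a : mup a (char_poly M) = 1%N ->
  x *m M = a *: x -> y *m M = a *: y -> dot x y = 0 -> (x == 0) || (y == 0).
Proof.
move=> mu1 xM yM xy0.
have [P [s [Pu rowPA]]] := real_eigenbasis.
(* The multiplicity of [a] in the product of the ['X - (s i)%:P] counts the indices with
   [s j = a]. *)
have [i si] : exists i, forall j, s j = a -> j = i.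
  move: mu1; rewrite (char_poly_eigenbasis Pu rowPA) -(big_map s xpredT (fun b => 'X - b%:P)).
  rewrite mu_prod_XsubC count_map => h.
  have : #|[pred j | s j == a]| == 1%N.
    by rewrite cardE size_filter -h; apply/eqP/eq_count.
  case/card1P => i hi; exists i => j /eqP sj.
  by have := hi j; rewrite !inE sj => /esym/eqP.
have coord (z : 'rV[R]_n) : z *m M = a *: z -> exists c : R[i]%C, toC z = c *: row i P.
  move=> zM; pose c := toC z *m invmx P; exists (c 0 i).
  have zc : toC z = c *m P by rewrite mulmxKV.
  have PA : P *m toC M = diag_mx (\row_i (s i)%:C%C) *m P.
    by apply/row_matrixP => k; rewrite row_mul rowPA mul_diag_mx; apply/rowP => j; rewrite !mxE.
  have cD : c *m diag_mx (\row_i (s i)%:C%C) = a%:C%C *: c.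
    apply: (can_inj (mulmxK Pu)); rewrite -mulmxA -PA mulmxA -zc -map_mxM zM.
    by rewrite map_mxZ zc scalemxAl.
  rewrite zc mulmx_sum_row (bigD1 i) //= big1 ?addr0 // => k ki.
  suff -> : c 0 k = 0 by rewrite scale0r.
  move/rowP: cD => /(_ k); rewrite mul_mx_diag !mxE mulrC => /eqP.
  rewrite -subr_eq0 -mulrBl mulf_eq0 => /orP[|/eqP //].
  rewrite subr_eq0 => /eqP/complexI/si ik; by rewrite ik eqxx in ki.
have [c xc] := coord _ xM; have [e ye] := coord _ yM.
have toC0 (z : 'rV[R]_n) : toC z = 0 -> z = 0.
  by move/rowP => h; apply/rowP => j; have := h j; rewrite !mxE => /complexI.
have [c0|c0] := eqVneq c 0; first by rewrite (toC0 x) ?eqxx // xc c0 scale0r.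
have yx : toC y = (e / c) *: toC x by rewrite xc scalerA divfK.
have : (e / c) * (dot x x)%:C%C = 0.
  rewrite -[RHS](_ : (dot x y)%:C%C = 0); last by rewrite xy0.
  rewrite !dotE !rmorph_sum big_distrr; apply: eq_bigr => j _ /=.
  have := congr1 (fun z : 'rV_n => z 0 j) yx; rewrite !mxE => h.
  by rewrite !rmorphM /= h; ring.
move/eqP; rewrite mulf_eq0 => /orP[/eqP ec|].
  by rewrite (toC0 y) ?eqxx ?orbT // yx ec scale0r.
by move/eqP/complexI/eqP; rewrite dot_eq0 => ->.
Qed.

Lemma eigproj_decomp x : x = \sum_(a <- spectrum M) x *m eigproj M a.
Proof. by rewrite -mulmx_sumr sum_eigproj mulmx1. Qed.

(** The components of [y] in the other eigenspaces are orthogonal to [x *m eigproj M a]. This is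
    self-adjointness and idempotence of the projection in one identity. *)
Lemma dot_eigproj a x y : dot (x *m eigproj M a) y = dot (x *m eigproj M a) (y *m eigproj M a).
Proof.
have [as_|as_] := boolP (a \in spectrum M); last first.
  suff -> : x *m eigproj M a = 0 by rewrite !dot0l.
  apply: contraNeq as_; apply: eigenvector_spectrum.
  exact: eigproj_eigenvector.
rewrite dotC {1}(eigproj_decomp y) dot_suml (bigD1_seq a) ?spectrum_uniq //=.
rewrite big1 ?addr0 1?dotC // => b ba.
exact: (eigenvectors_orth (eigproj_eigenvector _ _) (eigproj_eigenvector _ _)).
Qed.

Lemma eigproj_entry a u v :
  eigproj M a u v = dot (evec R u *m eigproj M a) (evec R v *m eigproj M a).
Proof. by rewrite -dot_eigproj dot_evec /evec -rowE [RHS]mxE. Qed.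

Lemma mulmx_eigproj a : eigproj M a *m M = a *: eigproj M a.
Proof. by apply/eigenspaceP; rewrite -[eigproj M a]mul1mx proj_mx_sub. Qed.

Definition spectral_weight u a : R := eigproj M a u u.

Lemma spectral_weightE u a : spectral_weight u a =
  dot (evec R u *m eigproj M a) (evec R u *m eigproj M a).
Proof. exact: eigproj_entry. Qed.

Lemma spectral_weight_ge0 u a : 0 <= spectral_weight u a.
Proof. by rewrite spectral_weightE dot_ge0. Qed.

Lemma spectral_weight_eq0 u a :
  (spectral_weight u a == 0) = (evec R u *m eigproj M a == 0).
Proof. by rewrite spectral_weightE dot_eq0. Qed.

Lemma sum_spectral_weight u : \sum_(a <- spectrum M) spectral_weight u a = 1.
Proof.
rewrite -[RHS](_ : (1%:M : 'M[R]_n) u u = 1); last by rewrite mxE eqxx.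
by rewrite -sum_eigproj summxE.
Qed.

Lemma spectral_weight_dot u a x : x *m M = a *: x ->
  dot (evec R u *m eigproj M a) x = x 0 u.
Proof.
move=> xM; rewrite dot_eigproj (eigproj_id xM) dotC -{1}(eigproj_id xM).
by rewrite -dot_eigproj (eigproj_id xM) dot_evec.
Qed.

End Symmetric.
End RealSymmetric.

(** * The transition matrix *)

Section UnitCircle.
Variable R : realType.
Implicit Types (x y t : R) (z : R[i]%C).

Definition expi x : R[i]%C := (cos x +i* sin x)%C.

Lemma expi0 : expi 0 = 1.
Proof. by rewrite /expi cos0 sin0. Qed.

Lemma expiD x y : expi (x + y) = expi x * expi y.
Proof. by rewrite /expi cosD sinD; congr (_ +i* _)%C; rewrite addrC. Qed.

Lemma expi_sum (I : Type) (r : seq I) (F : I -> R) :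
  expi (\sum_(i <- r) F i) = \prod_(i <- r) expi (F i).
Proof. exact: (big_morph expi expiD expi0). Qed.

Lemma expiMn x k : expi (k%:R * x) = expi x ^+ k.
Proof.
by elim: k => [|k IH]; rewrite ?mul0r ?expi0 // mulrS mulrDl mul1r expiD IH exprS.
Qed.

Lemma expiNM x : expi (- x) * expi x = 1.
Proof. by rewrite -expiD addNr expi0. Qed.

End UnitCircle.

Section Transition.
Local Open Scope classical_set_scope.
Variable R : realType.
Local Notation C := (R[i]%C : numFieldType).

Lemma cvg_mx_entries (K : numFieldType) m n (F : nat -> 'M[K]_(m, n)) (L : 'M[K]_(m, n)) :
  (forall i j, (fun N => F N i j) @ \oo --> L i j) -> F @ \oo --> L.
Proof.
move=> FL A [P LP sPA]; rewrite /nbhs /=.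
have : \forall N \near \oo, forall i j, P i j (F N i j).
  apply: filter_forall => i; apply: filter_forall => j.
  exact: FL (LP i j).
by apply: filterS => N hN; exact: sPA.
Qed.

Lemma cvg_complex (z : nat -> C) (a b : R) :
  (fun N => complex.Re (z N)) @ \oo --> a -> (fun N => complex.Im (z N)) @ \oo --> b ->
  z @ \oo --> ((a +i* b)%C : C).
Proof.
move=> za zb; apply/(@cvgrPdist_lt C C^o) => e e0.
(* Positivity in the order of [R[i]] forces [e] to be real, so half of it can bound both real
   errors. *)
have eR : e = (complex.Re e)%:C%C by apply/esym/RRe_real; exact: gtr0_real.
have r0 : 0 < complex.Re e by move: e0; rewrite eR ltcR.
have r20 : 0 < complex.Re e / 2 by rewrite divr_gt0.
move/cvgrPdist_lt : za => /(_ _ r20) za; move/cvgrPdist_lt : zb => /(_ _ r20) zb.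
near=> N; rewrite eR normc_def ltcR.
have ha : `|a - complex.Re (z N)| < complex.Re e / 2 by near: N.
have hb : `|b - complex.Im (z N)| < complex.Re e / 2 by near: N.
move: ha hb; case: (z N) => x y /=; set p := a - x; set q := b - y => ha hb.
rewrite -(ltr_pXn2r (n := 2)) ?nnegrE ?sqrtr_ge0 ?ltW // sqr_sqrtr ?addr_ge0 ?sqr_ge0 //.
have hp : p ^+ 2 < (complex.Re e / 2) ^+ 2.
  by rewrite -real_normK ?num_real // ltr_pXn2r // nnegrE ltW.
have hq : q ^+ 2 < (complex.Re e / 2) ^+ 2.
  by rewrite -real_normK ?num_real // ltr_pXn2r // nnegrE ltW.
nra.
Unshelve. all: by end_near. Qed.

Lemma cvg_lincomb (T : Type) (F : set_system T) (FF : Filter F) (r : seq R) (c l : R -> R)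
    (f : R -> T -> R) : (forall a, f a x @[x --> F] --> l a) ->
  \sum_(a <- r) c a * f a x @[x --> F] --> \sum_(a <- r) c a * l a.
Proof.
move=> fl; elim: r => [|a r IH].
  by rewrite big_nil; under eq_fun do rewrite big_nil; exact: cvg_cst.
rewrite big_cons; under eq_fun do rewrite big_cons.
by apply: cvgD => //; apply: cvgM => //; exact: cvg_cst.
Qed.

Lemma exp_coeff_imag (x : R) k : (k`!%:R^-1 : C) * ((x *i)%C : C) ^+ k =
  (cos_coeff x k +i* sin_coeff x k)%C.
Proof.
(* Even powers are real and odd ones imaginary; at [k = 0] the truncated [k.-1./2] does no harm
   because the factor [odd k] vanishes. *)
have iX : ((x *i)%C : C) ^+ k =
    ((~~ odd k)%:R * (-1) ^+ k./2 * x ^+ k +i* ((odd k)%:R * (-1) ^+ k.-1./2 * x ^+ k))%C.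
  elim: k => [|k IH]; first by rewrite expr0 /= !mul1r mul0r mul0r.
  rewrite exprSr IH; apply/eqP; rewrite eq_complex /=; apply/andP; split; apply/eqP.
    case: k {IH} => [|k]; first by rewrite /=; ring.
    by rewrite /= negbK; case: (odd k) => /=; rewrite ?exprS; ring.
  by rewrite mulr0 addr0 exprSr mulrA.
rewrite iX -(rmorph_nat (real_complex R)) -fmorphV.
rewrite /cos_coeff /sin_coeff /=; apply/eqP; rewrite eq_complex /= -?exprnP.
by rewrite !mul0r subr0 addr0 [_^-1 * _]mulrC [X in _ && (X == _)]mulrC !eqxx.
Qed.

Variables (n : nat) (M : 'M[R]_n) (symM : M^T = M).

Lemma cvg_cos_coeff (x : R) : series (cos_coeff x) @ \oo --> cos x.
Proof. by rewrite unlock; exact: is_cvg_series_cos_coeff. Qed.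

Lemma cvg_sin_coeff (x : R) : series (sin_coeff x) @ \oo --> sin x.
Proof. by rewrite unlock; exact: is_cvg_series_sin_coeff. Qed.

Local Notation toC := (map_mx (real_complex R)).

Lemma expr_imag_mx (t : R) k : (((t *i)%C : C) *: (toC M : 'M[C]_n)) ^+ k =
  \sum_(a <- spectrum M) (((t * a) *i)%C : C) ^+ k *: (toC (eigproj M a) : 'M[C]_n).
Proof.
elim: k => [|k IH].
  rewrite expr0; under eq_bigr do rewrite expr0 scale1r.
  by rewrite -map_mx_sum sum_eigproj // map_mx1.
rewrite exprSr IH mulr_suml; apply: eq_bigr => a _.
rewrite -[_ * _]/(_ *m _) -scalemxAl -scalemxAr scalerA -map_mxM mulmx_eigproj map_mxZ scalerA.
congr (_ *: _); rewrite exprSr -mulrA; congr (_ * _).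
by apply/eqP; rewrite eq_complex /=; apply/andP; split; apply/eqP; ring.
Qed.

Definition walk_amplitude (t : R) (u v : 'I_n) : R[i]%C :=
  \sum_(a <- spectrum M) (eigproj M a u v)%:C%C * expi (t * a).

Lemma transition_entry (t : R) u v : transition M t u v = walk_amplitude t u v.
Proof.
rewrite /transition /expmx.
set F := series _.
pose L : 'M[C]_n := \matrix_(u, v) walk_amplitude t u v.
pose G k : 'M[C]_n := (k`!%:R)^-1 *: \sum_(a <- spectrum M)
  (((t * a) *i)%C : C) ^+ k *: (toC (eigproj M a) : 'M[C]_n).
have {F}-> : F = series G.
  by congr series; apply: funext => k; congr (_ *: _); exact: expr_imag_mx.
set F := series G.
suff FL : F @ \oo --> L.
  by rewrite (cvg_lim _ FL) ?mxE //; exact: norm_hausdorff.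
apply: cvg_mx_entries => i j; rewrite mxE.
have -> : walk_amplitude t i j =
    ((\sum_(a <- spectrum M) eigproj M a i j * cos (t * a)) +i*
     (\sum_(a <- spectrum M) eigproj M a i j * sin (t * a)))%C.
  rewrite /walk_amplitude; apply/eqP; rewrite eq_complex; apply/andP.
  split; apply/eqP.
    by rewrite [LHS]Re_sum; apply: eq_bigr => a _; exact: ReZ.
  by rewrite [LHS]Im_sum; apply: eq_bigr => a _; exact: ImZ.
(* The real and imaginary parts of a partial sum are combinations of partial sums of the cosine and
   sine series. *)
have FE N : F N i j = ((\sum_(a <- spectrum M) eigproj M a i j * series (cos_coeff (t * a)) N) +i*
     (\sum_(a <- spectrum M) eigproj M a i j * series (sin_coeff (t * a)) N))%C.
  rewrite /F /series /= summxE.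
  have GE k : G k i j = \sum_(a <- spectrum M)
      (eigproj M a i j)%:C%C * (cos_coeff (t * a) k +i* sin_coeff (t * a) k)%C.
    rewrite /G mxE summxE big_distrr /=; apply: eq_bigr => a _.
    by rewrite 2![in LHS]mxE mulrA exp_coeff_imag mulrC.
  rewrite (eq_bigr _ (fun k _ => GE k)).
  rewrite exchange_big /=.
  apply/eqP; rewrite eq_complex; apply/andP.
  split; apply/eqP.
    rewrite [LHS]Re_sum; apply: eq_bigr => a _.
    by rewrite [LHS]Re_sum big_distrr; apply: eq_bigr => k _; exact: ReZ.
  rewrite [LHS]Im_sum; apply: eq_bigr => a _.
  by rewrite [LHS]Im_sum big_distrr; apply: eq_bigr => k _; exact: ImZ.
rewrite (funext FE); apply: cvg_complex => /=.
  exact: (@cvg_lincomb _ _ _ _ (fun a => eigproj M a i j) (fun a => cos (t * a))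
    (fun a => series (cos_coeff (t * a))) (fun a => @cvg_cos_coeff (t * a))).
exact: (@cvg_lincomb _ _ _ _ (fun a => eigproj M a i j) (fun a => sin (t * a))
    (fun a => series (sin_coeff (t * a))) (fun a => @cvg_sin_coeff (t * a))).
Qed.

(** Multiplication by the phase [expi (- (t * th))] preserves the modulus, so the eigenvalues may be
    measured from any reference point [th]. *)
Lemma return_modulusE u (t th : R) : return_modulus M u t =
  ComplexField.Normc.normc
    (\sum_(a <- spectrum M) (spectral_weight M u a)%:C%C * expi (t * (a - th))).
Proof.
rewrite /return_modulus transition_entry /walk_amplitude.
have nE x : ComplexField.Normc.normc (expi x) = 1 :> R.
  by rewrite /= cos2Dsin2 sqrtr1.
rewrite -[LHS]mul1r -(nE (- (t * th))) -ComplexField.Normc.normcM.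
congr (ComplexField.Normc.normc _).
rewrite big_distrr; apply: eq_bigr => a _ /=.
by rewrite mulrCA -expiD; congr (_ * expi _); ring.
Qed.

End Transition.

(** * Kronecker approximation *)

Section Kronecker.
Variable R : realType.
Let rcM (a b : R) : (a * b)%:C%C = a%:C%C * b%:C%C. Proof. exact: rmorphM. Qed.
Let rcB (a b : R) : (a - b)%:C%C = a%:C%C - b%:C%C. Proof. exact: rmorphB. Qed.
Let rcN (a : R) : (- a)%:C%C = - a%:C%C. Proof. exact: rmorphN. Qed.
Let rcV (a : R) : (a^-1)%:C%C = a%:C%C^-1. Proof. exact: fmorphV. Qed.
Let rcX (a : R) k : (a ^+ k)%:C%C = a%:C%C ^+ k. Proof. exact: rmorphXn. Qed.
Let rcn k : (k%:R : R)%:C%C = k%:R. Proof. exact: rmorph_nat. Qed.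
Let rc1 : (1 : R)%:C%C = 1. Proof. by []. Qed.

Implicit Types (x t h : R) (p : nat).

(** Each term is a difference: [2 sin (x/2) cos (x s) = sin (x s + x/2) - sin (x s - x/2)]. *)
Lemma sum_cos_telescope x N :
  2 * sin (x / 2) * (\sum_(s < N) cos (x * s%:R)) =
  sin (x * N%:R - x / 2) + sin (x / 2).
Proof.
elim: N => [|N IH]; first by rewrite big_ord0 !mulr0 sub0r sinN addNr.
rewrite big_ord_recr /= mulrDr IH.
have -> : x * N.+1%:R - x / 2 = x * N%:R + x / 2 by rewrite -natr1; lra.
by rewrite sinB sinD; lra.
Qed.

(** The bound is independent of [N], so such a frequency disappears when averaged over many
    samples. *)
Lemma norm_sum_cos_le x N : sin (x / 2) != 0 ->
  `|\sum_(s < N) cos (x * s%:R)| <= `|sin (x / 2)|^-1.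
Proof.
move=> s0; rewrite -[leRHS]mul1r ler_pdivlMr ?normr_gt0 // mulrC -normrM.
have -> : sin (x / 2) * (\sum_(s < N) cos (x * s%:R)) =
    (sin (x * N%:R - x / 2) + sin (x / 2)) / 2.
  by rewrite -sum_cos_telescope; field.
rewrite normrM [X in _ * X]ger0_norm ?invr_ge0 // ler_pdivrMr // mul1r.
apply: le_trans (ler_normD _ _) _.
have := sin_max (x * N%:R - x / 2); have := sin_max (x / 2); lra.
Qed.

(* Fourier coefficients of [((1 - cos x) / 2) ^ p = sin (x / 2) ^ (2 p)]; the frequency
   [i - p] carries the sign [(-1) ^ (i - p)]. *)
Definition sin_pow_coef p (i : nat) : R := (-1) ^+ (p + i) * 'C(p.*2, i)%:R / 4 ^+ p.

(** With [z = expi x] and [w = 1 / z] one has [(1 - cos x) / 2 = - w (1 - z)^2 / 4]; the binomial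
    theorem expands the [2 p]-th power of [1 - z], and [w ^+ p] shifts the frequencies by [- p]. *)
Lemma sin_pow_fourier p x : (((1 - cos x) / 2) ^+ p)%:C%C =
  \sum_(i < p.*2.+1) (sin_pow_coef p i)%:C%C * expi ((i%:R - p%:R) * x).
Proof.
pose z := expi x; pose w := expi (- x).
have wz : w * z = 1 by exact: expiNM.
have zw : z + w = (2 * cos x)%:C%C.
  rewrite /z /w /expi cosN sinN; apply/eqP; rewrite eq_complex /=; apply/andP.
  by split; apply/eqP; lra.
have e1 : ((1 - cos x) / 2)%:C%C = - w * (1 - z) ^+ 2 / 4.
  have -> : - w * (1 - z) ^+ 2 / 4 = - (z + w - 2) / 4 + (1 - w * z) * (z - 2) / 4 by field.
  rewrite wz subrr !mul0r addr0 zw.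
  have -> : (1 - cos x) / 2 = - (2 * cos x - 2) / 4 by field.
  by rewrite [LHS]rcM [in LHS]rcN rcB rcV !rcn.
have -> : (((1 - cos x) / 2) ^+ p)%:C%C = (-1) ^+ p * w ^+ p * (1 - z) ^+ p.*2 / 4 ^+ p.
  rewrite rcX e1 -mul2n exprM; move: ((1 - z) ^+ 2) => y.
  by rewrite -[- w]mulN1r !exprMn exprVn.
rewrite exprBn big_distrr big_distrl /=.
apply: eq_bigr => i _.
have -> : expi ((i%:R - p%:R) * x) = w ^+ p * z ^+ i.
  by rewrite /w /z -!expiMn -expiD; congr expi; ring.
rewrite /sin_pow_coef !rcM rcV !rcX rcN rc1 !rcn.
by rewrite expr1n exprD -mulr_natr; ring.
Qed.

(** A test function for simultaneous approximation: all factors lie in [[0, 1]], and for [p > 0] the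
    product is 1 exactly when every [al j * t] is an odd multiple of [pi]. *)
Definition sin_prod k (al : 'I_k -> R) p t : R :=
  \prod_j ((1 - cos (al j * t)) / 2) ^+ p.

Definition freq k p (al : 'I_k -> R) (f : {ffun 'I_k -> 'I_p.*2.+1}) : R :=
  \sum_j ((f j)%:R - p%:R) * al j.

Lemma sin_prod_fourier k (al : 'I_k -> R) p t : sin_prod al p t =
  \sum_(f : {ffun 'I_k -> 'I_p.*2.+1})
     (\prod_j sin_pow_coef p (f j)) * cos (freq al f * t).
Proof.
transitivity (complex.Re (sin_prod al p t)%:C%C) => //.
rewrite rmorph_prod /=.
under eq_bigr do rewrite sin_pow_fourier.
rewrite bigA_distr_bigA raddf_sum; apply: eq_bigr => f _ /=.
rewrite big_split /= -rmorph_prod -expi_sum ReZ /=.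
by rewrite /freq mulr_suml; congr (_ * cos _); apply: eq_bigr => j _; rewrite mulrA.
Qed.

(** Induction by the recurrence [(p+1) C(2p+2, p+1) = 2 (2p+1) C(2p, p)] and [4 (p+1) <= 2 (2p+3)].
    It makes the mean of [sin_prod] decay only polynomially in [p]. *)
Lemma central_bin_ge p : (4 ^ p <= p.*2.+1 * 'C(p.*2, p))%N.
Proof.
elim: p => [|p IH]; first by rewrite bin0.
have h : (p.+1 * 'C(p.+1.*2, p.+1) = 2 * (p.*2.+1 * 'C(p.*2, p)))%N.
  have e1 := mul_bin_diag p.+1.*2 p; have e2 := mul_bin_down p.*2.+1 p.
  rewrite /= in e1 e2; rewrite -e1 e2 doubleS.
  have -> : (p.*2.+1 - p = p.+1)%N by lia.
  by rewrite mulnA; congr (_ * _)%N; lia.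
rewrite -(leq_pmul2l (ltn0Sn p)) [leqRHS]mulnCA h expnS.
move: (p.*2.+1 * _)%N IH => c; rewrite doubleS => IH.
apply: (@leq_trans (p.+1 * (4 * c))); first by rewrite !leq_mul2l IH orbT.
by rewrite !mulnA leq_mul2r; apply/orP; right; lia.
Qed.

(* On average over [t], only the vanishing frequencies of the expansion of [sin_prod] survive;
   by the parity hypothesis their coefficients are nonnegative, and the zero tuple alone
   contributes the left-hand side.  The step [h] is small enough for no nonzero frequency to be
   aliased to [0]. *)
Lemma sin_prod_mean k (al : 'I_k -> R) p (r : R) :
  (forall m : 'I_k -> int, \sum_j (m j)%:~R * al j = 0 -> ~~ odd `|(\sum_j m j)%R|%N) ->
  (forall t, 0 <= t -> sin_prod al p t <= r) ->
  ('C(p.*2, p)%:R / 4 ^+ p) ^+ k <= r.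
Proof.
move=> even_rel ler; rewrite leNgt; apply/negP => ltr.
pose F := {ffun 'I_k -> 'I_p.*2.+1}.
pose c (f : F) : R := \prod_j sin_pow_coef p (f j).
pose mu (f : F) := freq al f.
pose h : R := (1 + \sum_f `|mu f|)^-1.
have S0 : 0 <= \sum_f `|mu f| by apply: sumr_ge0.
have h0 : 0 < h by rewrite invr_gt0; lra.
have sin_neq0 f : mu f != 0 -> sin (mu f * h / 2) != 0.
  move=> f0; rewrite -normr_gt0.
  have nf : 0 < `|mu f| by rewrite normr_gt0.
  have hf : `|mu f| * h <= 1.
    rewrite ler_pdivrMr; last lra.
    by rewrite mul1r (bigD1 f) //= ler_wpDl // lerDl sumr_ge0.
  have : 0 < sin (`|mu f| * h / 2).
    apply: sin_gt0_pi; have := pi_ge2 R; have : 0 < `|mu f| * h by exact: mulr_gt0.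
    by move=> ? ?; lra.
  have [m0|m0] := ger0P (mu f); first by move=> ?; rewrite normr_gt0 gt_eqF.
  by rewrite !mulNr sinN oppr_gt0 => ?; rewrite normr_gt0 lt_eqF.
pose B : R := \sum_f `|c f| * `|sin (mu f * h / 2)|^-1.
pose f0 : F := [ffun=> inord p].
have f0E j : f0 j = p :> nat by rewrite ffunE inordK // ltnS -addnn leq_addl.
have muf0 : mu f0 = 0.
  by rewrite /mu /freq big1 // => j _; rewrite f0E subrr mul0r.
have cf0 : c f0 = ('C(p.*2, p)%:R / 4 ^+ p) ^+ k.
  rewrite /c -[k in RHS]card_ord -prodr_const; apply: eq_bigr => j _.
  by rewrite /sin_pow_coef f0E addnn -signr_odd odd_double mul1r.
(* A vanishing frequency is an integer relation with coefficients [f j - p]; their sum has the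
   parity of the exponent of [-1] in [c f]. *)
have cf_ge0 f : mu f = 0 -> 0 <= c f.
  move=> m0; have := even_rel (fun j => (f j)%:Z - p%:Z).
  have -> : \sum_j ((f j)%:Z - p%:Z)%:~R * al j = mu f.
    by apply: eq_bigr => j _; rewrite rmorphB.
  move=> /(_ m0); rewrite sumrB sumr_const card_ord -(big_morph Posz PoszD (erefl _)) => ev.
  have -> : c f = \prod_j ((-1) ^+ (p + f j) * ('C(p.*2, f j)%:R / 4 ^+ p)).
    by apply: eq_bigr => j _; rewrite /sin_pow_coef mulrA.
  rewrite big_split /= prodrXr mulr_ge0 //; last first.
    by apply: prodr_ge0 => j _; rewrite mulr_ge0 ?invr_ge0 ?exprn_ge0.
  rewrite -signr_odd; suff -> : odd (\sum_j (p + f j)) = false by [].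
  apply: negbTE; rewrite big_split /= sum_nat_const card_ord.
  by move: ev; move: (\sum_j _)%N => Q; lia.
(* Summation over the samples [h * s], [s < N]: the nonzero frequencies contribute at least [- B],
   uniformly in [N], so a large [N] contradicts [r < c f0]. *)
have key N : N%:R * c f0 - B <= N%:R * r.
  have : \sum_(s < N) sin_prod al p (h * s%:R) <= N%:R * r.
    rewrite mulr_natl -[N in leRHS]card_ord -sumr_const; apply: ler_sum => s _.
    by apply: ler; rewrite mulr_ge0 // ltW.
  apply: le_trans.
  under eq_bigr do rewrite sin_prod_fourier.
  rewrite exchange_big /=.
  under eq_bigr => f _. rewrite -mulr_sumr. over.
  rewrite (bigD1 f0) //= -/(c f0).
  have -> : \sum_(s < N) cos (freq al f0 * (h * s%:R)) = N%:R.
    rewrite -[N in RHS]card_ord -sumr_const; apply: eq_bigr => s _.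
    by rewrite -/(mu f0) muf0 mul0r cos0.
  rewrite mulrC lerD2l -sumrN [leLHS](bigD1 f0) //=.
  apply: (@le_trans _ _ (\sum_(f | f != f0) - (`|c f| * `|sin (mu f * h / 2)|^-1))).
    by rewrite gerDr oppr_le0 mulr_ge0 // invr_ge0.
  apply: ler_sum => f _; have [m0|m0] := eqVneq (mu f) 0.
    apply: (@le_trans _ _ 0); first by rewrite oppr_le0 mulr_ge0 // invr_ge0.
    rewrite mulr_ge0 ?cf_ge0 // sumr_ge0 // => s _.
    by rewrite -/(mu f) m0 mul0r cos0.
  rewrite lerNl; apply: le_trans (ler_norm _) _; rewrite normrN normrM ler_wpM2l //.
  under eq_bigr do rewrite mulrA.
  exact: norm_sum_cos_le (sin_neq0 _ m0).
have d0 : 0 < c f0 - r by rewrite cf0 subr_gt0.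
have /archi_boundP : 0 <= B / (c f0 - r).
  by rewrite mulr_ge0 ?invr_ge0 ?(ltW d0) // sumr_ge0 // => f _; rewrite mulr_ge0 // invr_ge0.
rewrite ltr_pdivrMr //; set N := Num.bound _ => hN.
have := key N; lra.
Qed.

(** For [p = l (k+1)], Bernoulli's inequality gives [r^-p >= (l h)^(k+1)] with [h = 1/r - 1], of
    degree [k+1] in [l], whereas the polynomial factor is at most [(K l)^k]; [l] is chosen with
    [l h^(k+1) > K^k]. *)
Lemma decay_pow_lt (r : R) k : 0 < r < 1 -> exists p, r ^+ p * p.*2.+1%:R ^+ k < 1.
Proof.
case/andP=> r0 r1; pose h := r^-1 - 1.
have h0 : 0 < h by rewrite subr_gt0 invf_gt1.
pose K : R := (k.+1).*2.+1%:R.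
have K0 : 0 < K by rewrite ltr0n.
have hk0 : 0 < h ^+ k.+1 by exact: exprn_gt0.
have /archi_boundP : 0 <= K ^+ k / h ^+ k.+1 by rewrite divr_ge0 ?exprn_ge0 // ltW.
rewrite ltr_pdivrMr //; set l := Num.bound _ => hl.
have l0 : (0 < l)%N.
  by rewrite lt0n; apply: contraTneq hl => ->; rewrite mul0r -leNgt exprn_ge0 // ltW.
have l0R : 0 < l%:R :> R by rewrite ltr0n.
exists (l * k.+1)%N; rewrite -[r]invrK exprVn mulrC ltr_pdivrMr; last first.
  by rewrite exprn_gt0 // invr_gt0.
rewrite mul1r.
have b1 : (1 + l%:R * h) <= r^-1 ^+ l.
  have -> : r^-1 = 1 + h by rewrite /h; lra.
  elim: (l) => [|q IH]; first by rewrite mul0r addr0.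
  rewrite exprS -natr1; apply: le_trans (ler_wpM2l _ IH); last lra.
  have : 0 <= q%:R * h * h by rewrite !mulr_ge0 // ltW.
  lra.
have lh0 : 0 <= l%:R * h by rewrite mulr_ge0 // ltW.
rewrite exprM.
apply: (@lt_le_trans _ _ ((l%:R * h) ^+ k.+1)); last first.
  by apply: lerXn2r; rewrite ?nnegrE ?exprn_ge0 ?invr_ge0 ?(ltW r0) //; lra.
apply: (@le_lt_trans _ _ ((K * l%:R) ^+ k)).
  apply: lerXn2r; rewrite ?nnegrE ?mulr_ge0 ?(ltW K0) ?(ltW l0R) //.
  have -> : K * l%:R = (k.+1.*2.+1 * l)%:R by rewrite natrM.
  by rewrite ler_nat; nia.
rewrite !exprMn exprS mulrC -!mulrA; move: hl; rewrite exprS => hl.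
have lk : 0 < (l%:R : R) ^+ k by exact: exprn_gt0.
rewrite [ltRHS](_ : _ = l%:R ^+ k * (l%:R * (h * h ^+ k))); last by ring.
by rewrite ltr_pM2l.
Qed.

(* Kronecker's theorem for the phases [pi]: were the conclusion false, [sin_prod] would be at
   most [r ^ p] with [r < 1], whereas its mean decays only polynomially in [p]. *)
Lemma kronecker_pi k (al : 'I_k -> R) (d : R) : 0 < d ->
  (forall m : 'I_k -> int, \sum_j (m j)%:~R * al j = 0 -> ~~ odd `|(\sum_j m j)%R|%N) ->
  exists2 t, 0 <= t & forall j, cos (al j * t) <= -1 + d.
Proof.
move=> d0 even_rel.
(* This puts [r = 1 - d / 2] strictly between 0 and 1. *)
wlog d1 : d d0 / d <= 1.
  move=> H; have [d1|d1] := leP d 1; first exact: H.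
  by case: (H 1 ltr01 (lexx _)) => t t0 ht; exists t => // j; apply: le_trans (ht j) _; lra.
apply: contrapT => no.
pose r := 1 - d / 2.
have [|p hp] := @decay_pow_lt r k; first by rewrite /r; lra.
have cos01 t j : 0 <= (1 - cos (al j * t)) / 2 <= 1.
  by have := cos_le1 (al j * t); have := cos_geN1 (al j * t); lra.
have : ('C(p.*2, p)%:R / 4 ^+ p) ^+ k <= r ^+ p.
  apply: sin_prod_mean even_rel _ => t t0.
  have [j hj] : exists j, ~ (cos (al j * t) <= -1 + d).
    apply: contrapT => hn; apply: no; exists t => // j.
    by apply: contrapT => hj; apply: hn; exists j.
  move/negP: hj; rewrite -ltNge => hj.
  rewrite /sin_prod (bigD1 j) //= -[leRHS]mulr1; apply: ler_pM.
  - by apply: exprn_ge0; case/andP: (cos01 t j).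
  - by apply: prodr_ge0 => i _; apply: exprn_ge0; case/andP: (cos01 t i).
  - by apply: lerXn2r; rewrite ?nnegrE /r; have := cos01 t j; lra.
  - by apply: prodr_ile1 => i _; rewrite exprn_ge0 ?exprn_ile1 //; case/andP: (cos01 t i).
have c0 : 0 < 4 ^+ p :> R by exact: exprn_gt0.
have a_ge : (p.*2.+1%:R)^-1 <= 'C(p.*2, p)%:R / 4 ^+ p :> R.
  rewrite ler_pdivlMr // mulrC ler_pdivrMr ?ltr0n // -natrM -natrX ler_nat mulnC.
  exact: central_bin_ge.
apply/negP; rewrite -ltNge.
apply: (@lt_le_trans _ _ ((p.*2.+1%:R)^-1 ^+ k)); last first.
  by apply: lerXn2r; rewrite ?nnegrE // ?divr_ge0 // ltW.
by rewrite exprVn -[ltRHS]mul1r ltr_pdivlMr ?exprn_gt0.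
Qed.

End Kronecker.

(** * Twins *)

Section TwinPair.
Variables (R : realType) (n : nat) (M : 'M[R]_n) (symM : M^T = M).
Variables (theta : R) (u v : 'I_n) (uv : u != v).
Local Notation d := (evec R u - evec R v).
Hypothesis dM : d *m M = theta *: d.

Let dE w : d 0 w = (w == u)%:R - (w == v)%:R.
Proof. by rewrite !mxE eqxx. Qed.

Let du : d 0 u = 1.
Proof. by rewrite dE eqxx (negPf uv) subr0. Qed.

Let dv : d 0 v = -1.
Proof. by rewrite dE eqxx eq_sym (negPf uv) sub0r. Qed.

Lemma dot_twin_diff x : dot x d = x 0 u - x 0 v.
Proof. by rewrite dotC dotBl ![dot (evec R _) _]dotC !dot_evec. Qed.

Lemma twin_diff_neq0 : d != 0.
Proof. by apply/eqP => /rowP/(_ u)/eqP; rewrite du mxE oner_eq0. Qed.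

Lemma theta_spectrum : theta \in spectrum M.
Proof. exact: eigenvector_spectrum dM twin_diff_neq0. Qed.

Lemma eigproj_twins a : a != theta -> evec R u *m eigproj M a = evec R v *m eigproj M a.
Proof.
move=> at_; apply/eqP; rewrite -subr_eq0 -mulmxBl.
by rewrite (eigproj_0 symM dM) // eq_sym.
Qed.

Lemma theta_eigproj_diff :
  evec R u *m eigproj M theta - evec R v *m eigproj M theta = d.
Proof. by rewrite -mulmxBl eigproj_id. Qed.

Lemma theta_sigma_plus : theta \notin sigma_plus M u v.
Proof.
rewrite mem_filter; apply/negP => /andP[/andP[/eqP e _] _].
by have := twin_diff_neq0; rewrite -theta_eigproj_diff e subrr eqxx.
Qed.

(* The component of [evec R u *m eigproj M theta] orthogonal to [d]: it vanishes exactly when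
   [u] and [v] are strongly cospectral. *)
Definition theta_excess : 'rV[R]_n := evec R u *m eigproj M theta - 2^-1 *: d.
Local Notation z := theta_excess.

Lemma theta_excess_eigenvector : z *m M = theta *: z.
Proof.
by rewrite /theta_excess mulmxBl -scalemxAl dM eigproj_eigenvector [RHS]scalerBr !scalerA mulrC.
Qed.

Lemma theta_excess_orth : dot z d = 0.
Proof.
rewrite dotBl (spectral_weight_dot symM) // du dotZl dot_twin_diff du dv; lra.
Qed.

(** Since [z] is orthogonal to [d], pairing it with itself amounts to pairing it with the projection
    of [evec R u], which reads off its entry at [u]. Thus a nonzero [z] does not vanish at [u] and
    can itself serve as the extra eigenvector. *)
Lemma theta_excess_sqnorm : dot z z = z 0 u.
Proof.
rewrite {1}/theta_excess dotBl dotZl [dot d z]dotC theta_excess_orth mulr0 subr0.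
by rewrite (spectral_weight_dot symM) // theta_excess_eigenvector.
Qed.

(** Pythagoras for the orthogonal sum of [z] and [2^-1 *: d], the latter having squared norm 1/2. *)
Lemma spectral_weight_theta : spectral_weight M u theta = 2^-1 + dot z z.
Proof.
have e : evec R u *m eigproj M theta = z + 2^-1 *: d by rewrite subrK.
have dd : dot d d = 2 by rewrite dot_twin_diff du dv; lra.
rewrite spectral_weightE // e; move: theta_excess_orth; move: z => y yd.
rewrite dotDl dotZl ![dot _ (y + _)]dotC !dotDl !dotZl [dot d y]dotC yd dd; lra.
Qed.

(** If [z] were 0, the projection of [evec R u] would be [2^-1 *: d], and the entry at [u] of a
    [theta]-eigenvector orthogonal to [d] would vanish; by orthogonality its entries at [u] and [v]
    agree. *)
Lemma extra_eigenvector_weight :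
  extra_eigenvector M theta u v -> 2^-1 < spectral_weight M u theta.
Proof.
case=> y [yM _ /rowP/(_ 0)]; rewrite [RHS]mxE -/(dot y d) => yd ynz.
rewrite spectral_weight_theta ltrDl lt_neqAle dot_ge0 andbT eq_sym dot_eq0.
have yuv : y 0 u = y 0 v by move: yd; rewrite dot_twin_diff => /eqP; rewrite subr_eq0 => /eqP.
have yu : y 0 u != 0 by case: ynz; rewrite ?yuv.
apply: contraNneq yu => z0.
rewrite -(spectral_weight_dot symM u yM) -[X in dot X _](subrK (2^-1 *: d)).
by rewrite -/theta_excess z0 add0r dotZl dotC yd mulr0.
Qed.

Lemma no_extra_theta_excess : ~ extra_eigenvector M theta u v -> z = 0.
Proof.
move=> noex; apply/eqP; apply: contrapT => /negP z0; apply: noex.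
exists z; split.
- exact: theta_excess_eigenvector.
- apply: contraNN z0 => /sub_rVP[c zc].
  by rewrite -dot_eq0 {1}zc dotZl dotC theta_excess_orth mulr0.
- by apply/rowP => i; rewrite ord1 -[LHS]/(dot z d) theta_excess_orth mxE.
- by left; rewrite -theta_excess_sqnorm dot_eq0.
Qed.

Lemma theta_excess0_eigproj : z = 0 ->
  evec R u *m eigproj M theta = - (evec R v *m eigproj M theta).
Proof.
move=> z0; have e : evec R u *m eigproj M theta = 2^-1 *: d.
  by apply/eqP; rewrite -subr_eq0; apply/eqP.
have := theta_eigproj_diff; rewrite e => h.
have -> : evec R v *m eigproj M theta = 2^-1 *: d - d by rewrite -{2}h opprB addrC subrK.
apply/eqP; rewrite opprB eq_sym subr_eq -scalerDl (_ : 2^-1 + 2^-1 = 1) ?scale1r //; lra.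
Qed.

Lemma no_extra_strongly_cospectral :
  ~ extra_eigenvector M theta u v -> strongly_cospectral M u v.
Proof.
move=> /no_extra_theta_excess z0 a _; have [->|at_] := eqVneq a theta.
  by right; exact: theta_excess0_eigproj.
by left; exact: eigproj_twins.
Qed.

Lemma strongly_cospectral_theta_excess : strongly_cospectral M u v -> z = 0.
Proof.
move=> /(_ _ theta_spectrum) sc; have h := theta_eigproj_diff.
case: sc => e.
  by have := twin_diff_neq0; rewrite -h e subrr eqxx.
have : evec R u *m eigproj M theta = 2^-1 *: d; last by rewrite /theta_excess => ->; rewrite subrr.
move: (evec R u *m _) (evec R v *m _) h e => y y' h e.
by rewrite -h -e -mulr2n -[y *+ 2]scaler_nat scalerA mulVf ?scale1r // pnatr_eq0.
Qed.

Lemma strongly_cospectral_no_extra :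
  strongly_cospectral M u v -> ~ extra_eigenvector M theta u v.
Proof.
move=> /strongly_cospectral_theta_excess z0 /extra_eigenvector_weight.
by rewrite spectral_weight_theta z0 dot0l addr0 ltxx.
Qed.

(** The [theta]-projections of [evec R u] and [evec R w] have inner products 1 and 0 with [d], so
    they cannot agree up to sign. *)
Lemma not_strongly_cospectral_third w :
  w != u -> w != v -> ~ strongly_cospectral M u w.
Proof.
move=> wu wv /(_ _ theta_spectrum) sc.
have e1 := spectral_weight_dot symM u dM; have e2 := spectral_weight_dot symM w dM.
rewrite du in e1; rewrite dE (negPf wu) (negPf wv) subrr in e2.
case: sc => e; move: e1; rewrite e ?dotNl e2 => /eqP; rewrite ?oppr0 eq_sym oner_eq0 //.
Qed.

Lemma simple_no_extra : simple_eigenvalue M theta -> ~ extra_eigenvector M theta u v.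
Proof.
move=> simp [y [yM nsub /rowP/(_ 0)]]; rewrite [RHS]mxE -/(dot y d) => yd ynz.
have := simple_eigenvectors symM simp yM dM yd; rewrite (negPf twin_diff_neq0) orbF.
by move=> /eqP y0; case: ynz; rewrite y0 mxE eqxx.
Qed.

End TwinPair.

(** * Twin sets and their common eigenvalue *)

Section TwinSets.
Variables (R : realType) (n : nat) (X : wgraph R n) (q om eta : R) (T : {set 'I_n}).
Hypothesis HT : twin_set X om eta T.
Local Notation M := (genadjmx q X).

Lemma genadjmx_sym : M^T = M.
Proof.
apply/matrixP => i j; rewrite !mxE weight_sym; congr (_ * _ + _).
by case: eqVneq => [->|]; rewrite ?mulr0n ?mulr1n.
Qed.

Let pT : pairwise_twins X om eta T. Proof. by case/maxsetP: HT. Qed.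

Lemma twin_set_card : (2 <= #|T|)%N.
Proof. by case/and3P: pT. Qed.

Lemma twin_set_loop u : u \in T -> weight X u u = om.
Proof. by case/and3P: pT => _ /forall_inP h _ uT; apply/eqP; exact: h. Qed.

Lemma twin_set_pair u v : u \in T -> v \in T -> u != v -> twins X u v /\ weight X u v = eta.
Proof.
case/and3P: pT => _ _ /forall_inP h uT vT uv.
by have /forall_inP/(_ _ vT)/implyP/(_ uv)/andP[? /eqP] := h u uT.
Qed.

(** [twins] compares weights only on the neighbourhood of [u]; elsewhere both weights are
    nonnegative and not positive, hence 0. *)
Lemma twin_weight u v w : u \in T -> v \in T -> u != v -> w != u -> w != v ->
  weight X u w = weight X v w.
Proof.
move=> uT vT uv wu wv.
have [/and4P[_ /eqP/setP/(_ w) h /forall_inP hw _] _] := twin_set_pair uT vT uv.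
rewrite !inE (negPf wu) (negPf wv) /= in h.
have [w0|w0] := boolP (0 < weight X u w).
  by apply/eqP/hw; rewrite !inE (negPf wu) (negPf wv).
have w0' := w0; rewrite h in w0'.
have z x : ~~ (0 < weight X x w) -> weight X x w = 0.
  by rewrite -leNgt => x0; apply: le_anti; rewrite x0 weight_ge0.
by rewrite (z u w0) (z v w0').
Qed.

Lemma twin_deg u v : u \in T -> v \in T -> deg X u = deg X v.
Proof.
move=> uT vT; have [->//|uv] := eqVneq u v.
rewrite /deg !twin_set_loop //; congr (_ + _).
have vu : v != u by rewrite eq_sym.
rewrite (bigD1 v) //= [RHS](bigD1 u) //= weight_sym; congr (_ + _).
rewrite (eq_bigl (fun j => (j != v) && (j != u))) => [|j]; last by rewrite andbC.
by apply: eq_bigr => j /andP[jv ju]; apply: twin_weight.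
Qed.

Lemma twin_eigenvector u v w : u \in T -> v \in T -> w \in T -> u != v ->
  (evec R u - evec R v) *m M = (q * deg X w + om - eta) *: (evec R u - evec R v).
Proof.
move=> uT vT wT uv; have [_ euv] := twin_set_pair uT vT uv.
rewrite (twin_deg wT uT) mulmxBl /evec -!rowE.
apply/rowP => j; rewrite !mxE eqxx /=.
have [ju|ju] := eqVneq j u; [rewrite ju | have [jv|jv] := eqVneq j v; [rewrite jv|]].
- rewrite ?eqxx [v == u]eq_sym (negPf uv) ?mulr1n ?mulr0n.
  by rewrite twin_set_loop // [weight X v u]weight_sym euv; lra.
- rewrite /= ?mulr1n ?mulr0n.
  by rewrite twin_set_loop // euv -(twin_deg uT vT); lra.
rewrite /= !mulr0n.
by rewrite (twin_weight uT vT) //; lra.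
Qed.

Variables (w : 'I_n) (wT : w \in T).
Local Notation theta := (q * deg X w + om - eta).

Lemma extra_eigenvectorC u v :
  extra_eigenvector M theta u v -> extra_eigenvector M theta v u.
Proof.
have e : evec R v - evec R u = - (evec R u - evec R v) by rewrite opprB.
case=> y [yM nsub yd ynz]; exists y; split=> //.
- by rewrite e eqmx_opp.
- by rewrite e linearN /= mulmxN yd oppr0.
- by case: ynz; [right|left].
Qed.

(** The witness is [e_u + e_v - 2 e_x], a sum of two twin differences that takes the value 1 at both
    [u] and [v]. *)
Lemma triple_extra_eigenvector u v x : u \in T -> v \in T -> x \in T ->
  u != v -> x != u -> x != v -> extra_eigenvector M theta u v.
Proof.
move=> uT vT xT uv xu xv; rewrite eq_sym in xu; rewrite eq_sym in xv.
have dM := twin_eigenvector uT vT wT uv.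
pose y := (evec R u - evec R x) + (evec R v - evec R x); exists y.
have yM : y *m M = theta *: y.
  by rewrite /y mulmxDl (twin_eigenvector uT xT wT xu) (twin_eigenvector vT xT wT xv) [RHS]scalerDr.
have yu : y 0 u = 1.
  by rewrite !mxE !eqxx (negPf xu) (negPf uv) /=; lra.
have yv : y 0 v = 1.
  by rewrite !mxE !eqxx (negPf xv) [v == u]eq_sym (negPf uv) /=; lra.
have yd : dot y (evec R u - evec R v) = 0 by rewrite dot_twin_diff yu yv subrr.
split=> //.
- apply/negP => /sub_rVP[c yc].
  have : y = 0 by apply/eqP; rewrite -dot_eq0 {1}yc dotZl dotC yd mulr0.
  by move=> /rowP/(_ u)/eqP; rewrite yu mxE oner_eq0.
- by apply/rowP => i; rewrite ord1 -[LHS]/(dot y _) yd mxE.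
- by left; rewrite yu oner_eq0.
Qed.

Lemma large_multiplicity_extra u : large_multiplicity M theta T -> u \in T ->
  exists v, [/\ v \in T, u != v & extra_eigenvector M theta u v].
Proof.
case=> [T3 uT|[x [y [TE xy ex]]]].
  have : (1 < #|T :\ u|)%N by move: T3; rewrite (cardsD1 u) uT.
  case/card_gt1P => v [x [/setD1P[vu vT] /setD1P[xu xT] vx]].
  exists v; split; rewrite // 1?eq_sym //.
  by apply: (@triple_extra_eigenvector _ _ x); rewrite // eq_sym.
rewrite TE !inE => /orP[]/eqP->.
  by exists y; rewrite !inE eqxx orbT.
exists x; split; [by rewrite !inE eqxx | by rewrite eq_sym | exact: extra_eigenvectorC].
Qed.

(** Let [x] be a twin of [u] for which an extra eigenvector exists. That eigenvector excludes
    [v = x], and the vector [e_u - e_x], zero at every other vertex, excludes the rest. *)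
Lemma large_multiplicity_not_strongly_cospectral u v :
  large_multiplicity M theta T -> u \in T -> v != u -> ~ strongly_cospectral M u v.
Proof.
move=> lm uT vu; have [x [xT ux ex]] := large_multiplicity_extra lm uT.
have dM := twin_eigenvector uT xT wT ux.
have [->|vx] := eqVneq v x; last first.
  exact: (not_strongly_cospectral_third genadjmx_sym ux dM vu vx).
by move/(strongly_cospectral_no_extra genadjmx_sym ux dM); exact.
Qed.

Lemma not_large_multiplicity_pair : ~ large_multiplicity M theta T ->
  exists u v, [/\ T = [set u; v]%SET, u != v & ~ extra_eigenvector M theta u v].
Proof.
move=> nlm; have T2 : #|T| == 2.
  rewrite eqn_leq twin_set_card andbT leqNgt; apply/negP => T3.
  by apply: nlm; left.
case/cards2P : T2 => u [v [uv TE]]; exists u, v; split=> // ex.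
by apply: nlm; right; exists u, v.
Qed.

Lemma simple_eigenvalue_strongly_cospectral : simple_eigenvalue M theta ->
  exists u v, [/\ T = [set u; v]%SET, u != v & strongly_cospectral M u v].
Proof.
move=> simp.
have [lm|nlm] := pselect (large_multiplicity M theta T).
  have [x [xT ux ex]] := large_multiplicity_extra lm wT.
  have dM := twin_eigenvector wT xT wT ux.
  by case: (simple_no_extra genadjmx_sym ux dM simp ex).
have [u [v [TE uv noex]]] := not_large_multiplicity_pair nlm; exists u, v; split=> //.
apply: (no_extra_strongly_cospectral genadjmx_sym uv) noex.
by apply: twin_eigenvector wT uv; rewrite TE !inE eqxx ?orbT.
Qed.

End TwinSets.

(** * Sedentariness *)

Section ReturnModulus.
Variables (R : realType) (n : nat) (M : 'M[R]_n).
Local Notation normc := ComplexField.Normc.normc.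

Lemma normc_ge0 (z : R[i]%C) : 0 <= normc z.
Proof. by case: z => x y; exact: sqrtr_ge0. Qed.

Lemma return_modulus_ge0 u t : 0 <= return_modulus M u t.
Proof. exact: normc_ge0. Qed.

Lemma sedentaryP u : sedentary M u <->
  exists2 C, 0 < C & forall t, 0 < t -> C <= return_modulus M u t.
Proof.
pose S := [set return_modulus M u t | t in [set t : R | 0 < t]]%classic.
(* [inf] is a greatest lower bound only for nonempty sets bounded below: 0 is a lower bound, and
   [t = 1] shows nonemptiness. *)
have lbS : has_lbound S by exists 0 => _ [t _ <-]; exact: return_modulus_ge0.
split=> -[C C0 hC]; exists C => //.
  by move=> t t0; apply: le_trans hC _; apply: (ge_inf lbS); exists t.
apply: lb_le_inf; first by exists (return_modulus M u 1), 1 => //=; exact: ltr01.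
by move=> _ [t t0 <-]; exact: hC.
Qed.

Lemma ReD (y z : R[i]%C) : complex.Re (y + z) = complex.Re y + complex.Re z.
Proof. by case: y; case: z. Qed.

Lemma Re_le_normc (z : R[i]%C) : complex.Re z <= normc z.
Proof.
case: z => x y /=; apply: le_trans (ler_norm x) _.
by rewrite -sqrtr_sqr ler_wsqrtr // lerDl sqr_ge0.
Qed.

Lemma normc_sum_le (I : Type) (r : seq I) (F : I -> R[i]%C) :
  normc (\sum_(i <- r) F i) <= \sum_(i <- r) normc (F i).
Proof.
elim: r => [|i r IH]; first by rewrite !big_nil ComplexField.Normc.normc0.
by rewrite !big_cons; apply: le_trans (le_normcD _ _) _; rewrite lerD2l.
Qed.

Hypothesis symM : M^T = M.

(** Measured from [th], the term of [th] is the constant real number [spectral_weight M u th], and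
    the real parts of the others sum to at least minus the remaining weight. *)
Lemma return_modulus_ge u th t : th \in spectrum M ->
  2 * spectral_weight M u th - 1 <= return_modulus M u t.
Proof.
move=> ths; rewrite (return_modulusE symM u t th); apply: le_trans (Re_le_normc _).
rewrite Re_sum (bigD1_seq th) ?spectrum_uniq // ReZ subrr mulr0 expi0 [complex.Re _]/=.
have := sum_spectral_weight symM u; rewrite (bigD1_seq th) ?spectrum_uniq //= => h.
have : \sum_(a <- spectrum M | a != th) - spectral_weight M u a <=
    \sum_(a <- spectrum M | a != th)
       complex.Re ((spectral_weight M u a)%:C%C * expi (t * (a - th))).
  apply: ler_sum => a _; rewrite ReZ /= -mulrN1 ler_wpM2l ?cos_geN1 //.
  exact: spectral_weight_ge0.
rewrite sumrN; lra.
Qed.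

End ReturnModulus.

(** * Return modulus of strongly cospectral twins *)

Section StronglyCospectralTwins.
Variables (R : realType) (n : nat) (M : 'M[R]_n) (symM : M^T = M).
Variables (theta : R) (u v : 'I_n) (uv : u != v).
Local Notation d := (evec R u - evec R v).
Hypothesis dM : d *m M = theta *: d.
Hypothesis sc : strongly_cospectral M u v.
Local Notation normc := ComplexField.Normc.normc.
Local Notation wt := (spectral_weight M u).
Local Notation sp := (sigma_plus M u v).

Lemma sigma_plus_uniq : uniq sp.
Proof. by rewrite filter_uniq // spectrum_uniq. Qed.

(** The two projections agree at every [a != theta] and differ at [theta], so only the support
    condition is left. *)
Lemma mem_sigma_plus a :
  (a \in sp) = [&& a \in spectrum M, a != theta & wt a != 0].
Proof.
have [->|at_] := eqVneq a theta; first by rewrite (negPf (theta_sigma_plus uv dM)) andbF.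
rewrite mem_filter (eigproj_twins symM dM at_) eqxx /= spectral_weight_eq0 //.
by rewrite (eigproj_twins symM dM at_) andbC.
Qed.

Lemma sigma_plus_weight_gt0 a : a \in sp -> 0 < wt a.
Proof.
by rewrite mem_sigma_plus => /and3P[_ _ w0]; rewrite lt_neqAle eq_sym w0 spectral_weight_ge0.
Qed.

Lemma weight_theta_half : wt theta = 2^-1.
Proof.
rewrite (spectral_weight_theta symM uv dM).
by rewrite (strongly_cospectral_theta_excess uv dM sc) dot0l addr0.
Qed.

Lemma sum_spectrum (V : nmodType) (F : R -> V) : (forall a, wt a = 0 -> F a = 0) ->
  \sum_(a <- spectrum M) F a = F theta + \sum_(a <- sp) F a.
Proof.
move=> F0; rewrite (bigD1_seq theta) ?spectrum_uniq ?(theta_spectrum uv dM) //=; congr (_ + _).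
rewrite big_filter [RHS]big_mkcond [LHS]big_mkcond /= [LHS]big_seq [RHS]big_seq.
apply: eq_bigr => a as_; have := mem_sigma_plus a; rewrite mem_filter as_ andbT => ->.
by case: eqVneq => //= _; case: eqVneq => [/F0|].
Qed.

Lemma sum_sigma_plus_weight : \sum_(a <- sp) wt a = 2^-1.
Proof.
have := sum_spectral_weight symM u; rewrite (sum_spectrum (F := wt)) // weight_theta_half; lra.
Qed.

Lemma return_modulus_twins t : return_modulus M u t =
  normc ((2^-1)%:C%C + \sum_(a <- sp) (wt a)%:C%C * expi (t * (a - theta))).
Proof.
rewrite (return_modulusE symM u t theta) sum_spectrum => [|a ->]; last by rewrite mul0r.
by rewrite subrr mulr0 expi0 mulr1 weight_theta_half.
Qed.

Lemma return_modulus_ge_cos t :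
  \sum_(a <- sp) wt a * (1 + cos (t * (a - theta))) <= return_modulus M u t.
Proof.
rewrite return_modulus_twins; apply: le_trans (Re_le_normc _).
rewrite ReD Re_sum /real_complex_def [complex.Re (_ +i* 0)%C]/= -sum_sigma_plus_weight -big_split.
by apply: ler_sum => a _; rewrite ReZ mulrDr mulr1.
Qed.

(** The constant 1/2 is spread over the terms as the sum of their weights, and
    [|1 + expi x|^2 = 2 (1 + cos x)]. *)
Lemma return_modulus_le_cos t (e : R) : (forall a, a \in sp -> cos (t * (a - theta)) <= -1 + e) ->
  return_modulus M u t <= Num.sqrt (2 * e) / 2.
Proof.
move=> he; rewrite return_modulus_twins.
have -> : (2^-1)%:C%C + \sum_(a <- sp) (wt a)%:C%C * expi (t * (a - theta)) =
    \sum_(a <- sp) (wt a)%:C%C * (1 + expi (t * (a - theta))).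
  rewrite -sum_sigma_plus_weight (rmorph_sum (real_complex R)) -big_split.
  by apply: eq_bigr => a _; rewrite [RHS]mulrDr mulr1.
apply: le_trans (normc_sum_le _ _) _; rewrite [leRHS]mulrC -sum_sigma_plus_weight big_distrl.
rewrite big_seq [leRHS]big_seq; apply: ler_sum => a as_.
rewrite ComplexField.Normc.normcM /= expr0n addr0 sqrtr_sqr ger0_norm ?spectral_weight_ge0 //.
rewrite ler_wpM2l ?spectral_weight_ge0 // ler_wsqrtr //.
have := he a as_; have := cos2Dsin2 (t * (a - theta)); set c := cos _; set s := sin _ => h1 h2.
rewrite add0r; lra.
Qed.

Lemma sin_sum_le (I : Type) (r : seq I) (F : I -> R) :
  `|sin (\sum_(i <- r) F i)| <= \sum_(i <- r) `|sin (F i)|.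
Proof.
elim: r => [|i r IH]; first by rewrite !big_nil sin0 normr0.
rewrite !big_cons sinD; apply: le_trans (ler_normD _ _) _; rewrite !normrM.
apply: lerD.
  by rewrite -[leRHS]mulr1 ler_wpM2l ?cos_max.
by apply: le_trans IH; rewrite -[leRHS]mul1r ler_wpM2r ?cos_max.
Qed.

Lemma sin_mulz_le (x : R) (m : int) : `|sin (m%:~R * x)| <= `|m|%:~R * `|sin x|.
Proof.
have nat_case k : `|sin (k%:R * x)| <= k%:R * `|sin x|.
  rewrite mulr_natl -[k in _ *+ k]card_ord -sumr_const; apply: le_trans (sin_sum_le _ _) _.
  by rewrite sumr_const card_ord mulr_natl.
case: (intP m) => [|k|k]; rewrite ?mulrNz ?mulNr ?sinN ?normrN.
- exact: (nat_case 0%N).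
- exact: (nat_case k.+1).
- exact: (nat_case k.+1).
Qed.

Lemma sin_odd_half_pi (m : int) : odd `|m|%N -> `|sin (m%:~R * (pi / 2))| = 1 :> R.
Proof.
move=> om.
have nat_case k : odd k -> `|sin (k%:R * (pi / 2))| = 1 :> R.
  move=> ok; rewrite -[k]odd_double_half ok natrD mulrDl mul1r addrC.
  elim: (k./2) => [|j IH]; first by rewrite mul0r add0r sin_pihalf normr1.
  rewrite doubleS -addn2 natrD mulrDl addrAC (_ : 2%:R * (pi / 2) = pi :> R); last by field.
  by rewrite sinDpi normrN.
case: (intP m) om => [//|k|k] ok; first exact: nat_case.
by rewrite mulrNz mulNr sinN normrN; apply: nat_case; rewrite abszN in ok.
Qed.

(* With [x a = t * (a - theta) / 2], the relation makes [\sum_a m a * (x a - pi / 2)] an odd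
   multiple of [pi / 2], whence [1 <= \sum_a |m a| |cos (x a)|], while each [cos (x a) ^ 2] is
   bounded by a multiple of the return modulus. *)
Lemma odd_relation_sedentary : odd_relation M theta u v -> sedentary M u.
Proof.
case=> m [rel oddm].
pose K : R := \sum_(a <- sp) `|m a|%:~R / Num.sqrt (2 * wt a).
(* The summand 1 makes the constant positive before [K] is known to be nonzero. *)
apply/sedentaryP; exists (1 + K ^+ 2)^-1 => [|t t0].
  by rewrite invr_gt0 ltr_pwDl // sqr_ge0.
set rho := return_modulus M u t.
have rho0 : 0 <= rho by exact: return_modulus_ge0.
pose x a := t * (a - theta) / 2.
(* The single term of [a] in [return_modulus_ge_cos] is [2 * wt a * cos (x a) ^+ 2]; the other terms
   are nonnegative. *)
have cosx a : a \in sp -> `|cos (x a)| <= Num.sqrt rho / Num.sqrt (2 * wt a).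
  move=> as_; have w0 := sigma_plus_weight_gt0 as_.
  have w20 : 0 < Num.sqrt (2 * wt a) by rewrite sqrtr_gt0; lra.
  rewrite ler_pdivlMr // -sqrtr_sqr -sqrtrM ?sqr_ge0 // ler_wsqrtr //.
  apply: le_trans (return_modulus_ge_cos t); rewrite (bigD1_seq a) ?sigma_plus_uniq //=.
  apply: ler_wpDr.
    by apply: sumr_ge0 => b _; rewrite mulr_ge0 ?spectral_weight_ge0 //.
  rewrite [t * (a - theta)](_ : _ = x a *+ 2); last by rewrite /x -mulr_natr; field.
  rewrite cos_mulr2n; lra.
have K1 : 1 <= Num.sqrt rho * K.
  rewrite -(sin_odd_half_pi oddm).
  have -> : (\sum_(a <- sp) m a)%:~R * (pi / 2) = - \sum_(a <- sp) (m a)%:~R * (x a - pi / 2).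
    have -> : \sum_(a <- sp) (m a)%:~R * (x a - pi / 2) =
        \sum_(a <- sp) (m a)%:~R * x a - (\sum_(a <- sp) m a)%:~R * (pi / 2).
      rewrite rmorph_sum big_distrl -sumrB; apply: eq_bigr => a _; exact: mulrBr.
    suff -> : \sum_(a <- sp) (m a)%:~R * x a = 0 by rewrite sub0r opprK.
    transitivity (t / 2 * \sum_(a <- sp) (m a)%:~R * (a - theta)); last by rewrite rel mulr0.
    by rewrite big_distrr; apply: eq_bigr => a _; rewrite /x /=; ring.
  rewrite sinN normrN; apply: le_trans (sin_sum_le _ _) _.
  rewrite /K big_distrr big_seq [leRHS]big_seq; apply: ler_sum => a as_ /=.
  apply: le_trans (sin_mulz_le _ _) _; rewrite sinBpihalf normrN.
  by rewrite mulrCA ler_wpM2l ?ler0z // cosx.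
have K0 : 0 <= K.
  by apply: sumr_ge0 => a _; rewrite divr_ge0 ?ler0z ?sqrtr_ge0.
have : 1 <= rho * K ^+ 2.
  have := @lerXn2r _ 2 1 (Num.sqrt rho * K); rewrite !nnegrE ler01 mulr_ge0 ?sqrtr_ge0 //.
  by rewrite expr1n exprMn sqr_sqrtr // => -> //.
have := sqr_ge0 K => K2; rewrite -[_^-1]mul1r ler_pdivrMr ?ltr_pwDl //; nra.
Qed.

(** Without an odd relation, Kronecker's theorem brings all the phases close to -1 at once, and the
    return modulus falls below any given constant. *)
Lemma sedentary_odd_relation : sedentary M u -> odd_relation M theta u v.
Proof.
move=> /sedentaryP[C C0 hC]; apply: contrapT => norel.
pose k := size sp; pose al (j : 'I_k) : R := nth 0 sp j - theta.
(* Kronecker's theorem may return [t = 0], which sedentariness does not cover. There the modulus is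
   1, so capping the bound at 1 rules this case out. *)
pose C' := Num.min C 1.
have C'0 : 0 < C' by rewrite lt_min C0 ltr01.
have [|t t0 ht] := @kronecker_pi R k al (C' ^+ 2) (exprn_gt0 _ C'0).
  move=> m rel; apply/negP => oddm; apply: norel.
  (* Transport of a relation from indices to eigenvalues, with value 0 off [sp]. *)
  pose m' (a : R) : int := if insub (index a sp) is Some j then m j else 0.
  have m'E (j : 'I_k) : m' (nth 0 sp j) = m j.
    by rewrite /m' index_uniq ?sigma_plus_uniq // valK.
  exists m'; split; rewrite (big_nth 0) big_mkord.
    by rewrite -[RHS]rel; apply: eq_bigr => j _; rewrite m'E.
  by rewrite (eq_bigr m).
have hlt : return_modulus M u t < C'.
  (* The tolerance [C' ^+ 2] bounds the modulus by [C' / sqrt 2]. *)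
  apply: (@le_lt_trans _ _ (Num.sqrt (2 * C' ^+ 2) / 2)).
    apply: return_modulus_le_cos => a as_.
    have ia : (index a sp < k)%N by rewrite index_mem.
    by have := ht (Ordinal ia); rewrite /al /= nth_index // mulrC.
  rewrite sqrtrM // sqrtr_sqr ger0_norm ?(ltW C'0) //.
  have : Num.sqrt 2 < 2 :> R.
    by rewrite -[ltRHS]ger0_norm // -sqrtr_sqr ltr_sqrt // ; lra.
  move=> s2; nra.
have [t00|t00] := eqVneq t 0.
  move: hlt; rewrite t00 return_modulus_twins.
  under eq_bigr do rewrite mul0r expi0 mulr1.
  rewrite -rmorph_sum sum_sigma_plus_weight -rmorphD /= expr0n addr0 sqrtr_sqr.
  rewrite ger0_norm; last lra.
  rewrite lt_min => /andP[_]; lra.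
have := hC t; rewrite lt_neqAle eq_sym t00 t0 => /(_ isT).
by apply/negP; rewrite -ltNge; apply: lt_le_trans hlt _; rewrite ge_min lexx.
Qed.

End StronglyCospectralTwins.

(** * Arithmetic of the eigenvalues *)

Section Parity.
Implicit Types x y m : int.

Lemma odd_abszD x y : odd `|(x + y)%R|%N = odd `|x|%N (+) odd `|y|%N.
Proof. by lia. Qed.

Lemma odd_abszM x y : odd `|(x * y)%R|%N = odd `|x|%N && odd `|y|%N.
Proof. by rewrite abszM oddM. Qed.

Lemma odd_absz_sum_mul (I : eqType) (r : seq I) (m b : I -> int) :
  {in r, forall i, odd `|b i|%N} ->
  odd `|(\sum_(i <- r) m i * b i)%R|%N = odd `|(\sum_(i <- r) m i)%R|%N.
Proof.
elim: r => [|i r IH] ob; first by rewrite !big_nil.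
rewrite !big_cons !odd_abszD odd_abszM ob ?mem_head // andbT IH // => j jr.
by rewrite ob // in_cons jr orbT.
Qed.

Lemma int_2adic x : x != 0 ->
  exists2 y, x = (2 ^ logn 2 `|x|%N)%N%:Z * y & odd `|y|%N.
Proof.
move=> x0; have xp : (0 < `|x|%N)%N by rewrite absz_gt0.
have [//|k ok xk] := @pfactor_coprime 2 `|x|%N _ xp.
exists (sgz x * k%:Z); last first.
  by rewrite abszM absz_sg x0 mul1n /= -coprime2n.
by rewrite mulrCA -PoszM mulnC -xk -intEsg.
Qed.

End Parity.

(** * Square-free parts *)

Section SquareFree.

Lemma squarefree_decomposition N : (0 < N)%N ->
  exists g D, [/\ N = (g ^ 2 * D)%N, (0 < D)%N & squarefree D].
Proof.
elim: {N}_.+1 {-2}N (ltnSn N) => // k IH N Nk N0.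
have [sf|] := pselect (squarefree N); first by exists 1%N, N; rewrite exp1n mul1n.
move/existsNP => [d /not_implyP[/dvdnP[N' NE] d1]].
have d0 : (0 < d)%N by rewrite lt0n; apply: contraTneq N0 => d0; rewrite NE d0 muln0.
have N'0 : (0 < N')%N by rewrite lt0n; apply: contraTneq N0 => e; rewrite NE e.
have [|//|g [D [N'E D0 sf]]] := IH N'.
  rewrite -ltnS; apply: leq_trans Nk; rewrite ltnS NE ltn_Pmulr //.
  by rewrite -[1%N](exp1n 2) ltn_exp2r //; move/eqP: d1; lia.
by exists (g * d)%N, D; split; rewrite // NE N'E expnMn; lia.
Qed.

(** Once the gcd is divided out, the square of the reduced [y] divides [D], hence is 1. This turns a
    rational multiple of [sqrt D] whose square is an integer into an integer multiple. *)
Lemma squarefree_dvd x y D N : (0 < y)%N -> squarefree D ->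
  (x ^ 2 * D = N * y ^ 2)%N -> (y %| x)%N.
Proof.
move=> y0 sf e; set g := gcdn x y.
have g0 : (0 < g)%N by rewrite gcdn_gt0 y0 orbT.
have /dvdnP[x' xE] := dvdn_gcdl x y; have /dvdnP[y' yE] := dvdn_gcdr x y.
rewrite -/g in xE yE.
have cop : coprime x' y'.
  by rewrite /coprime -(eqn_pmul2r g0) muln_gcdl -xE -yE mul1n.
have e' : (x' ^ 2 * D = N * y' ^ 2)%N.
  have g20 : (0 < g ^ 2)%N by rewrite expn_gt0 g0.
  apply/eqP; rewrite -(eqn_pmul2r g20); apply/eqP.
  by move: e; rewrite {1}xE {1}yE !expnMn => e; rewrite mulnAC e mulnA.
have : (y' ^ 2 %| D)%N.
  have cop2 : coprime (y' ^ 2) (x' ^ 2).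
    by rewrite coprime_pexpl // coprime_pexpr // coprime_sym.
  by rewrite -(Gauss_dvdr _ cop2) e' dvdn_mull.
by move/sf => y'1; rewrite yE y'1 mul1n dvdn_gcdl.
Qed.

End SquareFree.

(** * Algebraic integers and power sums *)

Section Integrality.
Variable R : realType.
Local Notation integral := (integralOver (intr : int -> R)).

(** By Gauss's lemma a rational multiple of ['X - r%:P] is an integral factor of [q]; as [q] is
    monic, its leading coefficient is a unit, so [r] is an integer. *)
Lemma monic_int_root_rat (q : {poly int}) (r : rat) :
  q \is monic -> root (map_poly intr q) r -> exists z : int, r = z%:~R.
Proof.
move=> qm; rewrite root_factor_theorem => /dvdpP_rat_int[p1 [a a0 pE] [s qE]].
have lc : lead_coef p1 * lead_coef s = 1 by rewrite -lead_coefM -qE (monicP qm).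
have l1 : lead_coef p1 = 1 \/ lead_coef p1 = -1.
  have /eqP := congr1 absz lc; rewrite abszM muln_eq1 => /andP[/eqP e _]; lia.
have ea : a * (lead_coef p1)%:~R = 1.
  have := lead_coefXsubC r; rewrite pE lead_coefZ lead_coef_map_inj //; exact: intr_inj.
have aE : a = (lead_coef p1)%:~R.
  move: ea; case: l1 => ->; first by rewrite mulr1.
  by rewrite rmorphN1 mulrN1 => /eqP; rewrite eqr_oppLR => /eqP.
have := congr1 (fun p : {poly rat} => p`_0) pE.
rewrite coefB coefX coefC coefZ coef_map /= sub0r aE => e.
by exists (- (lead_coef p1 * p1`_0)); rewrite rmorphN rmorphM /= -e opprK.
Qed.

Lemma integral_rat (r : rat) : integral (ratr r) -> exists z : int, r = z%:~R.
Proof.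
case=> q qm rq; apply: (monic_int_root_rat qm).
move: rq; rewrite (_ : map_poly intr q = map_poly ratr (map_poly (intr : int -> rat) q)).
  by rewrite fmorph_root.
by rewrite -map_poly_comp; apply: eq_map_poly => z /=; rewrite ratr_int.
Qed.

Lemma integral_div_int (x : R) (A B : int) : integral x -> A != 0 ->
  A%:~R * x = B%:~R -> exists z : int, x = z%:~R.
Proof.
move=> ix A0 e; have xE : x = ratr (B%:~R / A%:~R).
  by rewrite rmorphM fmorphV /= !ratr_int -e mulrC mulKf // intr_eq0.
by move: ix; rewrite xE => /integral_rat[z ->]; exists z; rewrite ratr_int.
Qed.

Lemma int_monic_root (p : {poly R}) (x : R) :
  p \is monic -> p \is a polyOver Num.int -> root p x -> integral x.
Proof.
move=> pm /floorpP[q pE] rx; exists q; last by rewrite -pE.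
move: pm; rewrite !monicE pE lead_coef_map_inj; [|exact: intr_inj|by []].
by rewrite -(rmorph1 (intr : int -> R)) => /eqP/intr_inj->.
Qed.

(** Newton's identity [2 e_2 = p_1^2 - p_2]. *)
Lemma coef2_prod_XsubC (s : seq R) i : i.+2 = size s ->
  2 * (\prod_(a <- s) ('X - a%:P))`_i = (\sum_(a <- s) a) ^+ 2 - \sum_(a <- s) a ^+ 2.
Proof.
elim: s i => // a s IH i [].
rewrite !big_cons mulrBl coefB coefCM coefXM.
have top : (\prod_(b <- s) ('X - b%:P))`_(size s).-1 = - \sum_(b <- s) b \/ s = [::].
  by case: (s) => [|b s']; [right|left; exact: coefPn_prod_XsubC].
case: i => [|i] si /=.
  case: s si IH top => [//|b [|//]] _ _ _.
  by rewrite !big_cons !big_nil mulr1 addr0 coefB coefX coefC /=; ring.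
case: top => [top|s0]; last by rewrite s0 in si.
by move: top; rewrite -si /= mulrBr (IH i si) => ->; ring.
Qed.

Lemma sum_roots_int (s : seq R) : \prod_(a <- s) ('X - a%:P) \is a polyOver Num.int ->
  exists z : int, \sum_(a <- s) a = z%:~R.
Proof.
move=> /polyOverP h; have [s0|s0] := eqVneq (size s) 0%N.
  by exists 0; rewrite (size0nil s0) big_nil.
have /intrP[z zE] := h (size s).-1.
by exists (- z); rewrite rmorphN /= -zE coefPn_prod_XsubC // opprK.
Qed.

Lemma sum_sq_roots_int (s : seq R) : \prod_(a <- s) ('X - a%:P) \is a polyOver Num.int ->
  (1 < size s)%N -> exists z : int, \sum_(a <- s) a ^+ 2 = z%:~R.
Proof.
move=> h s1; have [z zE] := sum_roots_int h.
have [i si] : exists i, i.+2 = size s by exists (size s).-2; lia.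
have /intrP[y yE] := (polyOverP h) i.
exists (z ^+ 2 - 2 * y); have := coef2_prod_XsubC si.
rewrite yE zE rmorphB rmorphXn rmorphM /=; lra.
Qed.

(* The first two power sums determine [dl ^ 2] rationally. *)
Lemma arithmetic_roots_sq (s : seq R) (th dl c : R) (k : R -> int) :
    \prod_(a <- s) ('X - a%:P) \is a polyOver Num.int -> uniq s ->
    {in s, forall a, a = th + (k a)%:~R * dl} ->
    th \in s -> c \in s -> c != th -> k th = 0 ->
  exists A B : int, A != 0 /\ A%:~R * dl ^+ 2 = B%:~R.
Proof.
move=> h us sE ths cs cth kth.
have s1 : (1 < size s)%N.
  case: s us ths cs {h sE} => [//|x [|//]] _; rewrite !inE => /eqP e1 /eqP e2.
  by rewrite e2 e1 eqxx in cth.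
have [z1 z1E] := sum_roots_int h; have [z2 z2E] := sum_sq_roots_int h s1.
pose N : int := (size s)%:Z; pose K1 := \sum_(a <- s) k a; pose K2 := \sum_(a <- s) k a ^+ 2.
exists (N * K2 - K1 ^+ 2), (N * z2 - z1 ^+ 2); split.
  have kc : k c != 0.
    by apply: contraNneq cth => kc0; rewrite (sE c cs) kc0 mul0r addr0.
  (* Up to scaling, [A] is the variance of the multipliers [k a]. It is nonzero because [k] vanishes
     at [th] but not at [c]. *)
  have e : N * (N * K2 - K1 ^+ 2) = \sum_(a <- s) (N * k a - K1) ^+ 2.
    have -> : \sum_(a <- s) (N * k a - K1) ^+ 2 =
        \sum_(a <- s) (N ^+ 2 * k a ^+ 2 - 2 * N * K1 * k a + K1 ^+ 2).
      by apply: eq_bigr => a _; ring.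
    rewrite big_split /= sumrB -!mulr_sumr -/K1 -/K2 big_const_seq count_predT iter_addr_0.
    by rewrite -mulr_natl -/N; ring.
  apply/eqP => A0; move: e; rewrite A0 mulr0 => /esym/eqP.
  rewrite psumr_eq0 => [/allP h0|a _]; last exact: sqr_ge0.
  have := h0 _ ths; have := h0 _ cs.
  rewrite /= !sqrf_eq0 kth mulr0 sub0r oppr_eq0 => /eqP e1 /eqP e2.
  move: e1; rewrite e2 subr0 => /eqP; rewrite mulf_eq0 (negPf kc) orbF /N; lia.
have e1 : z1%:~R = N%:~R * th + K1%:~R * dl.
  rewrite -z1E (eq_big_seq _ sE) big_split /= -mulr_suml -rmorph_sum; congr (_ + _).
  by rewrite big_const_seq count_predT iter_addr_0 -mulr_natl.
have e2 : z2%:~R = N%:~R * th ^+ 2 + 2 * K1%:~R * th * dl + K2%:~R * dl ^+ 2.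
  rewrite -z2E.
  have -> : \sum_(a <- s) a ^+ 2 =
     \sum_(a <- s) (th ^+ 2 + (2 * th * dl) * (k a)%:~R + dl ^+ 2 * (k a ^+ 2)%:~R).
    apply: eq_big_seq => a as_; transitivity ((th + (k a)%:~R * dl) ^+ 2); first by rewrite -sE.
    by rewrite [(k a) ^+ 2]expr2 intrM; ring.
  rewrite !big_split /= -!mulr_sumr -!rmorph_sum /= -/K1 -/K2.
  by rewrite big_const_seq count_predT iter_addr_0 -mulr_natl /N; ring.
by rewrite !rmorphB !rmorphM /= e1 e2; ring.
Qed.

End Integrality.

Section Trigonometry.
Variable R : realType.
Implicit Types x y : R.

Lemma expi_2pi_int (m : int) : expi (m%:~R * (pi *+ 2)) = 1 :> R[i]%C.
Proof.
have nat_case k : expi (k%:R * (pi *+ 2)) = 1 :> R[i]%C.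
  by rewrite expiMn /expi cos2pi sin2pi expr1n.
case: (intP m) => [|k|k]; [exact: (nat_case 0%N)|exact: (nat_case k.+1)|].
by rewrite mulrNz mulNr -[LHS]mulr1 -(nat_case k.+1) expiNM.
Qed.

(** Reduction modulo [2 pi] leaves [y] in [[0, 2 pi)]; for [y != 0], [sin (y/2) > 0] contradicts
    [cos y = 1 - 2 sin (y/2)^2]. *)
Lemma cos_eq1 x : cos x = 1 -> exists m : int, x = m%:~R * (pi *+ 2).
Proof.
move=> cx; have p0 : 0 < pi *+ 2 :> R by rewrite pmulrn_lgt0 // pi_gt0.
pose m := Num.floor (x / (pi *+ 2)); exists m.
pose y := x - m%:~R * (pi *+ 2).
have y0 : 0 <= y by rewrite subr_ge0 -ler_pdivlMr // floor_le_tmp.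
have y2 : y < pi *+ 2.
  by rewrite ltrBlDr -[X in X + _]mul1r -mulrDl -ltr_pdivrMr // addrC -intrD1 floorD1_gt.
have ey : expi y = expi x.
  by rewrite /y expiD -mulNr -rmorphN /= expi_2pi_int mulr1.
have cy : cos y = 1 by rewrite -cx; case: ey.
apply/eqP; rewrite -subr_eq0 -/y; apply/negPn/negP => yn0.
have s0 : 0 < sin (y / 2).
  have y1 : 0 < y by rewrite lt_neqAle eq_sym yn0.
  by apply: sin_gt0_pi; rewrite divr_gt0 //= ltr_pdivrMr // mulr_natr.
have : cos (y / 2 *+ 2) = 1 by rewrite -mulr_natr divfK.
have := cos2Dsin2 (y / 2); rewrite cos_mulr2n => h1 h2.
have : sin (y / 2) ^+ 2 = 0 by lra.
by move/eqP; rewrite sqrf_eq0 gt_eqF.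
Qed.

End Trigonometry.

(** * Quadratic eigenvalues and tight sedentariness *)

Section QuadraticForm.
Variables (R : realType) (n : nat) (M : 'M[R]_n) (symM : M^T = M).
Variables (theta : R) (u v : 'I_n) (uv : u != v).
Local Notation d := (evec R u - evec R v).
Hypothesis dM : d *m M = theta *: d.
Hypothesis sc : strongly_cospectral M u v.
Local Notation normc := ComplexField.Normc.normc.
Local Notation wt := (spectral_weight M u).
Local Notation sp := (sigma_plus M u v).

Let sp_neq a : a \in sp -> a != theta.
Proof. by rewrite (mem_sigma_plus symM uv dM) => /and3P[]. Qed.

Lemma sqrt_squarefree_gt0 D : D = 1%N \/ (1 < D)%N /\ squarefree D -> 0 < Num.sqrt D%:R :> R.
Proof. by rewrite sqrtr_gt0 ltr0n; case=> [->//|[D1 _]]; exact: ltnW. Qed.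

Lemma odd_relation_of_two (a c : R) (x y : int) : a \in sp -> c \in sp ->
    x%:~R * (a - theta) + y%:~R * (c - theta) = 0 -> a != c -> odd `|(x + y)%R|%N ->
  odd_relation M theta u v.
Proof.
move=> as_ cs rel ac oxy.
pose m b : int := if b == a then x else if b == c then y else 0.
have sumE (V : zmodType) (F : R -> V) : (forall b, m b = 0 -> F b = 0) ->
    \sum_(b <- sp) F b = F a + F c.
  move=> F0; rewrite (bigD1_seq a) ?sigma_plus_uniq //=; congr (_ + _).
  rewrite big_mkcond (bigD1_seq c) ?sigma_plus_uniq //= eq_sym ac.
  rewrite big1 ?addr0 // => b bc; case: ifP => // ba; apply: F0.
  by rewrite /m (negPf ba) (negPf bc).
have ma : m a = x by rewrite /m eqxx.
have mc : m c = y by rewrite /m eq_sym (negPf ac) eqxx.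
exists m; split; rewrite sumE ?ma ?mc // => b ->; exact: mul0r.
Qed.

(** If [b a = 2^e y] and [b c = 2^f z] with [e < f] and [y], [z] odd, then [2^(f-e) z] at [a] and
    [- y] at [c] form a relation with odd coefficient sum. *)
Lemma quadratic_form_odd_relation : quadratic_form M theta u v -> odd_relation M theta u v.
Proof.
case=> b [D [D1 bE [a0 [c0 [as0 cs0 nu0]]]]].
have sD := sqrt_squarefree_gt0 D1.
have bn0 x : x \in sp -> b x != 0.
  move=> xs; apply: contraNneq (sp_neq xs) => bx.
  by rewrite (bE x xs) bx mul0r addr0.
have [a [c [as_ cs nu]]] : exists a c,
    [/\ a \in sp, c \in sp & (logn 2 `|b a|%N < logn 2 `|b c|%N)%N].
  by move: nu0; rewrite neq_ltn => /orP[lt|lt]; [exists a0, c0|exists c0, a0].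
have ac : a != c by apply: contraTneq nu => ->; rewrite ltnn.
have [y yE oy] := int_2adic (bn0 _ as_); have [z zE oz] := int_2adic (bn0 _ cs).
set e := logn 2 _ in yE nu; set f := logn 2 _ in zE nu.
have fE : (2 ^ f)%N%:Z = (2 ^ e)%N%:Z * (2 ^ (f - e))%N%:Z.
  by rewrite -PoszM -expnD subnKC // ltnW.
apply: (@odd_relation_of_two a c ((2 ^ (f - e))%N%:Z * z) (- y)) => //.
  have -> : a - theta = (b a)%:~R * Num.sqrt D%:R by rewrite {1}(bE a as_) addrC addKr.
  have -> : c - theta = (b c)%:~R * Num.sqrt D%:R by rewrite {1}(bE c cs) addrC addKr.
  by rewrite yE zE fE !rmorphM rmorphN /=; ring.
rewrite odd_abszD odd_abszM abszN oy /= oddX subn_eq0 leqNgt nu //.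
Qed.

Lemma return_modulus_periodic (P : R) (m : R -> int) :
    (forall a, a \in sp -> P * (a - theta) = (m a)%:~R * (pi *+ 2)) ->
  forall (k : int) t, return_modulus M u (t + k%:~R * P) = return_modulus M u t.
Proof.
move=> mE k t; rewrite !(return_modulus_twins symM uv dM sc); congr (normc (_ + _)).
apply: eq_big_seq => a as_; congr (_ * _).
have -> : (t + k%:~R * P) * (a - theta) = t * (a - theta) + (k * m a)%:~R * (pi *+ 2).
  by rewrite rmorphM /= -mulrA -(mE a as_); ring.
by rewrite expiD expi_2pi_int mulr1.
Qed.

Lemma return_modulus_continuous : continuous (return_modulus M u).
Proof.
move=> t.
have -> : return_modulus M u = fun t => Num.sqrt
    ((2^-1 + \sum_(a <- sp) wt a * cos (t * (a - theta))) ^+ 2 +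
     (\sum_(a <- sp) wt a * sin (t * (a - theta))) ^+ 2).
  apply: funext => x; rewrite (return_modulus_twins symM uv dM sc).
  have -> : \sum_(a <- sp) (wt a)%:C%C * expi (x * (a - theta)) =
    ((\sum_(a <- sp) wt a * cos (x * (a - theta))) +i*
     (\sum_(a <- sp) wt a * sin (x * (a - theta))))%C.
    apply/eqP; rewrite eq_complex; apply/andP; split; apply/eqP.
      by rewrite [LHS]Re_sum; apply: eq_bigr => a _; exact: ReZ.
    by rewrite [LHS]Im_sum; apply: eq_bigr => a _; exact: ImZ.
  by rewrite /= add0r.
have cvgM_ a : (x * (a - theta) @[x --> t] --> t * (a - theta))%classic.
  by apply: cvgM; [exact: cvg_id | exact: cvg_cst].
apply: continuous_comp; last exact: sqrt_continuous.
apply: cvgD.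
  have h : ((2^-1 + \sum_(a <- sp) wt a * cos (x * (a - theta))) @[x --> t] -->
      2^-1 + \sum_(a <- sp) wt a * cos (t * (a - theta)))%classic.
    apply: cvgD; first exact: cvg_cst.
    apply: (@cvg_lincomb _ _ _ _ _ wt (fun a => cos (t * (a - theta)))
      (fun a x => cos (x * (a - theta)))) => a.
    by apply: (cvg_comp _ _ (cvgM_ a)); exact: continuous_cos.
  by rewrite expr2; under eq_fun do rewrite expr2; exact: (cvgM h h).
have h : ((\sum_(a <- sp) wt a * sin (x * (a - theta))) @[x --> t] -->
    \sum_(a <- sp) wt a * sin (t * (a - theta)))%classic.
  apply: (@cvg_lincomb _ _ _ _ _ wt (fun a => sin (t * (a - theta)))
    (fun a x => sin (x * (a - theta)))) => a.
  by apply: (cvg_comp _ _ (cvgM_ a)); exact: continuous_sin.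
by rewrite expr2; under eq_fun do rewrite expr2; exact: (cvgM h h).
Qed.

(** The return modulus is continuous and has period [2 pi / sqrt D], so it attains its minimum on
    one period. *)
Lemma quadratic_form_tightly_sedentary :
  quadratic_form M theta u v -> tightly_sedentary M u.
Proof.
move=> qf.
have sed := odd_relation_sedentary symM uv dM sc (quadratic_form_odd_relation qf).
case: qf => b [D [D1 bE _]]; have sD := sqrt_squarefree_gt0 D1.
pose P : R := pi *+ 2 / Num.sqrt D%:R.
have P0 : 0 < P by rewrite divr_gt0 // pmulrn_lgt0 // pi_gt0.
have per := @return_modulus_periodic P b.
have {}per : forall (k : int) t, return_modulus M u (t + k%:~R * P) = return_modulus M u t.
  apply: per => a as_; rewrite {1}(bE a as_) addrC addKr /P mulrCA divfK // gt_eqF //.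
(* The interval from [P] to [2 P], rather than from 0 to [P], makes the minimizer positive. *)
have [|c cP cmin] := @EVT_min R (return_modulus M u) P (P *+ 2) _
  (continuous_subspaceT return_modulus_continuous).
  by rewrite mulr2n lerDl ltW.
have c0 : 0 < c by move: cP; rewrite in_itv /= => /andP[Pc _]; exact: lt_le_trans Pc.
have {}cmin t : return_modulus M u c <= return_modulus M u t.
  pose k : int := 1 - Num.floor (t / P).
  rewrite -(per k t); apply: cmin; rewrite in_itv /=.
  have h1 : (Num.floor (t / P))%:~R * P <= t by rewrite -ler_pdivlMr // floor_le_tmp.
  have h2 : t < (Num.floor (t / P) + 1)%:~R * P by rewrite -ltr_pdivrMr // floorD1_gt.
  by move: h1 h2; rewrite /k !rmorphD rmorphN /= rmorph1; lra.
have infE : inf_return M u = return_modulus M u c.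
  apply/eqP; rewrite eq_le; apply/andP; split.
    apply: ge_inf; last by exists c.
    by exists 0 => _ [t _ <-]; exact: return_modulus_ge0.
  apply: lb_le_inf; first by exists (return_modulus M u c), c.
  by move=> _ [t _ <-]; exact: cmin.
split=> //; last by exists c.
by case: sed => C C0; exact: lt_le_trans.
Qed.

(** The part [Z] carried by [sp] has modulus at most 1/2, and [|1/2 + Z| = 1] forces its real part
    to be at least 1/2. So every cosine is 1 at time [tau], and [dl = 2 pi / tau]. *)
Lemma periodic_phases : walk_periodic M u ->
  exists2 dl : R, dl != 0 & forall a, a \in sp -> exists k : int, a = theta + k%:~R * dl.
Proof.
case=> tau tau0; rewrite (return_modulus_twins symM uv dM sc) => h.
have sw := sum_sigma_plus_weight symM uv dM sc.
have cos1 : forall a, a \in sp -> cos (tau * (a - theta)) = 1.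
  set Z := \sum_(a <- sp) _ in h.
  have Z2 : normc Z <= 2^-1.
    rewrite /Z -sw; apply: le_trans (normc_sum_le _ _) _; apply: ler_sum => a _.
    rewrite ComplexField.Normc.normcM /= cos2Dsin2 sqrtr1 mulr1 expr0n addr0 sqrtr_sqr.
    by rewrite ger0_norm // spectral_weight_ge0.
  have re : 2^-1 <= complex.Re Z.
    move: h Z2; case: Z => x y /=; rewrite add0r => h h2.
    have e1 : (2^-1 + x) ^+ 2 + y ^+ 2 = 1.
      by rewrite -[LHS]sqr_sqrtr ?addr_ge0 ?sqr_ge0 // h expr1n.
    have e2 : x ^+ 2 + y ^+ 2 <= 2^-1 ^+ 2.
      rewrite -[leLHS]sqr_sqrtr ?addr_ge0 ?sqr_ge0 //.
      by apply: lerXn2r => //; rewrite nnegrE ?sqrtr_ge0.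
    lra.
  have : \sum_(a <- sp) wt a * (1 - cos (tau * (a - theta))) <= 0.
    have -> : \sum_(a <- sp) wt a * (1 - cos (tau * (a - theta))) = 2^-1 - complex.Re Z.
      rewrite -sw /Z Re_sum -sumrB; apply: eq_bigr => a _.
      by rewrite ReZ mulrBr mulr1.
    by rewrite subr_le0.
  move=> le0 a as_.
  have ge0 b : 0 <= wt b * (1 - cos (tau * (b - theta))).
    by rewrite mulr_ge0 ?spectral_weight_ge0 // subr_ge0 cos_le1.
  move: le0; rewrite (bigD1_seq a) ?sigma_plus_uniq //=.
  have : 0 <= \sum_(b <- sp | b != a) wt b * (1 - cos (tau * (b - theta))) by apply: sumr_ge0.
  have := ge0 a; have w0 := sigma_plus_weight_gt0 symM uv dM as_ => h1 h2 h3.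
  have : wt a * (1 - cos (tau * (a - theta))) = 0 by lra.
  by move/eqP; rewrite mulf_eq0 gt_eqF //= subr_eq0 => /eqP.
exists (pi *+ 2 / tau) => [|a as_].
  by rewrite gt_eqF // divr_gt0 // pmulrn_lgt0 // pi_gt0.
have [k ke] := cos_eq1 (cos1 a as_); exists k; rewrite mulrA -ke.
by field; rewrite gt_eqF.
Qed.

Lemma mem_eigen_support a : (a \in eigen_support M u) = (a == theta) || (a \in sp).
Proof.
rewrite mem_filter -spectral_weight_eq0 // (mem_sigma_plus symM uv dM).
have [->|at_] := eqVneq a theta; last by rewrite /= andbC.
by rewrite (weight_theta_half symM uv dM sc) invr_eq0 pnatr_eq0 /= (theta_spectrum uv dM).
Qed.

Lemma sigma_plus_neq0 : exists c, c \in sp.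
Proof.
case: (sp) (sum_sigma_plus_weight symM uv dM sc) => [|c s _]; last by exists c; rewrite mem_head.
by rewrite big_nil => /eqP; rewrite eq_sym invr_eq0 pnatr_eq0.
Qed.

Lemma integral_support_quadratic : integral_support M u -> walk_periodic M u ->
  exists (b : R -> int) (D : nat), (D = 1%N \/ (1 < D)%N /\ squarefree D) /\
    forall a, a \in sp -> a = theta + (b a)%:~R * Num.sqrt D%:R.
Proof.
move=> int_supp /periodic_phases[dl dl0 phases].
have [k kE] : exists k : R -> int, forall a, a \in sp -> a = theta + (k a)%:~R * dl.
  have /choice[k kE] : forall a, exists k : int, a \in sp -> a = theta + k%:~R * dl.
    move=> a; have [as_|] := boolP (a \in sp); last by exists 0.
    by have [j jE] := phases a as_; exists j.
  by exists k.
have kD a : a \in sp -> a - theta = (k a)%:~R * dl.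
  by move=> as_; rewrite {1}(kE a as_) addrC addKr.
have kn0 a : a \in sp -> k a != 0.
  move=> as_; apply: contraNneq (sp_neq as_) => ka.
  by rewrite (kE a as_) ka mul0r addr0.
have [c cs] := sigma_plus_neq0.
pose S := eigen_support M u.
have thS : theta \in S by rewrite mem_eigen_support eqxx.
have spS a : a \in sp -> a \in S by rewrite mem_eigen_support => ->; rewrite orbT.
have [A [B [A0 AB]]] : exists A B : int, A != 0 /\ A%:~R * dl ^+ 2 = B%:~R.
  (* [k] is constrained only on [sp]; at [theta] the multiplier has to be 0. *)
  pose k' a := if a == theta then 0 else k a.
  apply: (@arithmetic_roots_sq R S theta dl c k') => //; rewrite ?spS ?sp_neq //.
  - by rewrite filter_uniq // spectrum_uniq.
  - move=> a; rewrite mem_eigen_support /k'; have [-> _|_ /= as_] := eqVneq a theta.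
      by rewrite mul0r addr0.
    exact: kE.
  - by rewrite /k' eqxx.
have intS a : a \in S -> integralOver (intr : int -> R) a.
  move=> aS; apply: (int_monic_root _ int_supp); first exact: monic_prod_XsubC.
  by rewrite root_prod_XsubC.
(* The square is rational because [A * dl ^+ 2 = B], and it is an algebraic integer. *)
have sqN a : a \in sp -> exists2 N : nat, (0 < N)%N & (a - theta) ^+ 2 = N%:R.
  move=> as_.
  have [z zE] : exists z : int, (a - theta) ^+ 2 = z%:~R.
    apply: (@integral_div_int R _ A (k a ^+ 2 * B)) => //.
      have i1 : integralOver (intr : int -> R) (a - theta).
        by apply: integral_sub; apply: intS; [exact: spS|].
      by rewrite expr2; exact: integral_mul.
    by rewrite (kD a as_) rmorphM /= -AB rmorphM /=; ring.
  have z0 : 0 < z.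
    by rewrite -(ltr0z R) -zE exprn_even_gt0 //= subr_eq0 sp_neq.
  exists `|z|%N; first by rewrite absz_gt0 gt_eqF.
  by rewrite zE -[z in LHS]gez0_abs // ltW.
(* The square-free part [D] found for one [c] serves all of [sp], since the ratios
   [(a - theta) / (c - theta)] are rational. *)
have [Nc Nc0 NcE] := sqN c cs.
have [g [D [NcD D0 sf]]] := squarefree_decomposition Nc0.
have D1 : D = 1%N \/ (1 < D)%N /\ squarefree D.
  by case: (ltngtP D 1%N) => [|D1|->]; [lia|right|left].
have sD := sqrt_squarefree_gt0 D1.
have g0 : (0 < g)%N by move: Nc0; rewrite NcD; case: (g) => //; rewrite mul0n.
have [e [e1 cE]] : exists e : int, (`|e|%N = 1%N) /\ c - theta = e%:~R * g%:R * Num.sqrt D%:R.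
  have : `|c - theta| = g%:R * Num.sqrt D%:R.
    by rewrite -sqrtr_sqr NcE NcD natrM natrX sqrtrM ?sqr_ge0 // sqrtr_sqr ger0_norm.
  have [cp|cn] := ger0P (c - theta) => h; [exists 1|exists (-1)]; split=> //.
    by rewrite mul1r.
  by rewrite mulN1r mulNr -h opprK.
have bex a : a \in sp -> exists b : int, a = theta + b%:~R * Num.sqrt D%:R.
  move=> as_; have [N N0 NE] := sqN a as_.
  have ratio : (k c)%:~R * (a - theta) = (k a)%:~R * (c - theta).
    by rewrite (kD a as_) (kD c cs); ring.
  (* The multiple of [sqrt D] in question is [k a * e * g / k c], and its square times [D] is the
     integer [N]. *)
  have /dvdzP[b bE] : (k c %| k a * e * g%:Z)%Z.
    rewrite dvdzE !abszM e1 muln1 /=; apply: (@squarefree_dvd _ _ D N) => //.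
      by rewrite absz_gt0 kn0.
    have sq (z : int) : (`|z|%N%:R : R) ^+ 2 = z%:~R ^+ 2.
      by rewrite natr_absz intr_norm real_normK ?num_real.
    apply/eqP; rewrite -(eqr_nat R) [X in X == _]natrM [X in _ == X]natrM !natrX natrM exprMn !sq.
    rewrite -NE -mulrA -natrX -natrM -NcD -NcE -!exprMn; apply/eqP; congr (_ ^+ 2).
    by rewrite -ratio mulrC.
  exists b; apply: (@mulfI _ (k c)%:~R); first by rewrite intr_eq0 kn0.
  rewrite mulrDr -[a in LHS](subrK theta) mulrDr ratio cE addrC; congr (_ + _).
  have := congr1 (fun z : int => z%:~R : R) bE; rewrite !rmorphM /= => h.
  by rewrite !mulrA h; ring.
have /choice[b bE] : forall a, exists b : int, a \in sp -> a = theta + b%:~R * Num.sqrt D%:R.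
  move=> a; have [as_|] := boolP (a \in sp); last by exists 0.
  by have [j jE] := bex a as_; exists j.
by exists b, D.
Qed.

(** If all the valuations were equal, dividing by the common power of 2 would leave a relation
    between odd integers [b' a], whose coefficient sum is even. *)
Lemma odd_relation_quadratic_form : integral_support M u -> walk_periodic M u ->
  odd_relation M theta u v -> quadratic_form M theta u v.
Proof.
move=> int_supp per [m [rel oddm]].
have [b [D [D1 bE]]] := integral_support_quadratic int_supp per.
have sD := sqrt_squarefree_gt0 D1.
have bD a : a \in sp -> a - theta = (b a)%:~R * Num.sqrt D%:R.
  by move=> as_; rewrite {1}(bE a as_) addrC addKr.
exists b, D; split=> //; apply: contrapT => alleq.
have [c cs] := sigma_plus_neq0.
have nu a : a \in sp -> logn 2 `|b a|%N = logn 2 `|b c|%N.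
  move=> as_; apply/eqP; apply: contrapT => /negP ne; apply: alleq.
  by exists a, c.
have bn0 x : x \in sp -> b x != 0.
  move=> xs; apply: contraNneq (sp_neq xs) => bx.
  by rewrite (bE x xs) bx mul0r addr0.
have /choice[b' b'E] : forall a, exists b' : int, a \in sp ->
    b a = (2 ^ logn 2 `|b c|%N)%N%:Z * b' /\ odd `|b'|%N.
  move=> a; have [as_|] := boolP (a \in sp); last by exists 0.
  by have [y yE oy] := int_2adic (bn0 a as_); exists y; rewrite -(nu a as_).
have : \sum_(a <- sp) m a * b' a = 0.
  apply/eqP; rewrite -(intr_eq0 R) rmorph_sum /=; apply/eqP.
  have f0 : (2 ^ logn 2 `|b c|%N)%N%:R * Num.sqrt D%:R != 0 :> R.
    by rewrite mulf_neq0 ?(gt_eqF sD) // pnatr_eq0 -lt0n expn_gt0.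
  apply: (mulfI f0); rewrite mulr0 -[RHS]rel mulr_sumr; apply: eq_big_seq => a as_ /=.
  rewrite (bD a as_) (b'E a as_).1 !rmorphM /=; ring.
move/(congr1 (fun z : int => odd `|z|%N)); rewrite odd_absz_sum_mul ?oddm // => a as_.
by case: (b'E a as_).
Qed.

End QuadraticForm.

Section Swap.
Variables (R : realType) (n : nat) (M : 'M[R]_n).

Lemma strongly_cospectralC u v : strongly_cospectral M u v -> strongly_cospectral M v u.
Proof. by move=> sc a /sc[->|->]; [left|right; rewrite opprK]. Qed.

Lemma sigma_plusC u v : sigma_plus M u v = sigma_plus M v u.
Proof. by apply: eq_in_filter => a _; rewrite eq_sym; case: eqP => // ->. Qed.

Lemma odd_relationC theta u v : odd_relation M theta u v -> odd_relation M theta v u.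
Proof. by rewrite /odd_relation sigma_plusC. Qed.

End Swap.

(** * Characterization of sedentary twin sets *)

Section TwinSetSedentary.
Variables (R : realType) (n : nat) (X : wgraph R n) (q om eta : R) (T : {set 'I_n}).
Hypothesis HT : twin_set X om eta T.
Variables (w : 'I_n) (wT : w \in T).
Local Notation M := (genadjmx q X).
Local Notation theta := (q * deg X w + om - eta).

Lemma large_multiplicity_sedentary u :
  large_multiplicity M theta T -> u \in T -> sedentary M u.
Proof.
move=> lm uT; have [v [vT uv ex]] := large_multiplicity_extra HT wT lm uT.
have dM := twin_eigenvector q HT uT vT wT uv.
have symM := genadjmx_sym X q.
have w2 := extra_eigenvector_weight symM uv dM ex.
apply/sedentaryP; exists (2 * spectral_weight M u theta - 1) => [|t _]; first by lra.
exact: return_modulus_ge symM u theta t (theta_spectrum uv dM).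
Qed.

Lemma twin_pair_sedentary u v : T = [set u; v]%SET -> u != v ->
  strongly_cospectral M u v -> odd_relation M theta u v -> sedentary M u.
Proof.
move=> TE uv; apply: (odd_relation_sedentary _ uv); first exact: genadjmx_sym.
by apply: (twin_eigenvector _ _ _ _ wT uv); rewrite // TE !inE eqxx ?orbT.
Qed.

Lemma twin_set_sedentary : (forall u, u \in T -> sedentary M u) <->
  large_multiplicity M theta T \/
  (exists u v, [/\ T = [set u; v]%SET, u != v,
     strongly_cospectral M u v & odd_relation M theta u v]).
Proof.
split=> [sed|[lm u|[u [v [TE uv sc oddr]]] x]]; last first.
- rewrite TE !inE => /orP[]/eqP->; first exact: (twin_pair_sedentary TE uv).
  apply: (twin_pair_sedentary (u := v) (v := u)).
  + by rewrite finset.setUC.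
  + by rewrite eq_sym.
  + exact: strongly_cospectralC.
  + exact: odd_relationC.
- exact: large_multiplicity_sedentary.
have [lm|nlm] := pselect (large_multiplicity M theta T); [by left|right].
have [u [v [TE uv noex]]] := not_large_multiplicity_pair HT nlm.
have uT : u \in T by rewrite TE !inE eqxx.
have vT : v \in T by rewrite TE !inE eqxx orbT.
have dM := twin_eigenvector q HT uT vT wT uv; have symM := genadjmx_sym X q.
have sc := no_extra_strongly_cospectral symM uv dM noex.
by exists u, v; split=> //; exact: (sedentary_odd_relation symM uv dM sc (sed u uT)).
Qed.

End TwinSetSedentary.

Theorem theorem14 (R : realType) (n : nat) (X : wgraph R n) (q om eta : R)
    (T : {set 'I_n}) (w : 'I_n) (HT : twin_set X om eta T) (wT : w \in T) :
  let M := genadjmx q X in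
  let theta := q * deg X w + om - eta in
  [/\ forall u v, u \in T -> v \in T -> u != v ->
        (evec R u - evec R v != 0) /\
        (evec R u - evec R v) *m M = theta *: (evec R u - evec R v),
      (forall u, u \in T -> sedentary M u) <->
        large_multiplicity M theta T \/
        (exists u v, [/\ T = [set u; v]%SET, u != v,
           strongly_cospectral M u v & odd_relation M theta u v]),
      large_multiplicity M theta T ->
        forall u v, u \in T -> v != u -> ~ strongly_cospectral M u v,
      simple_eigenvalue M theta ->
        exists u v, [/\ T = [set u; v]%SET, u != v & strongly_cospectral M u v]
    & forall u v, T = [set u; v]%SET -> u != v -> strongly_cospectral M u v ->
        char_poly M \is a polyOver Num.int -> walk_periodic M u ->
        [/\ integral_support M u ->
              (odd_relation M theta u v <-> quadratic_form M theta u v),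
            quadratic_form M theta u v -> odd_relation M theta u v
          & quadratic_form M theta u v -> tightly_sedentary M u]].
Proof.
move=> M theta; split.
- move=> u v uT vT uv; split; first exact: twin_diff_neq0.
  exact: (twin_eigenvector q HT uT vT wT uv).
- exact: (twin_set_sedentary q HT wT).
- by move=> lm u v; exact: (large_multiplicity_not_strongly_cospectral HT wT lm).
- exact: (simple_eigenvalue_strongly_cospectral HT wT).
move=> u v TE uv sc _ per.
have dM : (evec R u - evec R v) *m M = theta *: (evec R u - evec R v).
  by apply: (twin_eigenvector _ _ _ _ wT uv); rewrite // TE !inE eqxx ?orbT.
have symM : M^T = M := genadjmx_sym X q.
have odd_of_quad := quadratic_form_odd_relation symM uv dM.
split=> [int_supp||]; first by split; [exact: (odd_relation_quadratic_form symM uv dM sc)|].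
- exact: odd_of_quad.
- exact: (quadratic_form_tightly_sedentary symM uv dM sc).
Qed.
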